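(* Let $\mathcal{B}$ be an abelian category with enough projective objects and enough injective objects, let $\mathsf{F}:\mathcal{B}\to\mathcal{B}$ be an additive right exact functor with $\mathsf{F}^2=0$, and let $\mathcal{B}\ltimes\mathsf{F}$ be the right trivial extension. Let $\mathcal{M}_{\mathcal{B}}=(\mathcal{C},\mathcal{F},\mathcal{W})$ be a hereditary Hovey triple in $\mathcal{B}$. If $\mathbb{L}_1\mathsf{F}(C)=0$ for all $C\in\mathcal{C}$ and $\mathsf{F}(\mathcal{C})\subseteq\mathcal{F}\cap\mathcal{W}$, then $$\mathcal{M}_{\mathcal{B}\ltimes\mathsf{F}}=\big(\mathsf{T}(\mathcal{C}),\ \mathsf{U}^{-1}(\mathcal{F}),\ \mathsf{U}^{-1}(\mathcal{W})\big)$$ is a hereditary Hovey triple in $\mathcal{B}\ltimes\mathsf{F}$, and there is a triangle equivalence $\mathrm{Ho}(\mathcal{M}_{\mathcal{B}\ltimes\mathsf{F}})\simeq\mathrm{Ho}(\mathcal{M}_{\mathcal{B}})$.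
   Context: The right trivial extension $\mathcal{B}\ltimes\mathsf{F}$ has as objects the pairs $(X,f)$ with $X\in\mathcal{B}$ and $f:\mathsf{F}(X)\to X$ such that $f\circ\mathsf{F}(f)=0$ (automatic when $\mathsf{F}^2=0$); a morphism $(X,f)\to(Y,g)$ is a morphism $\alpha:X\to Y$ in $\mathcal{B}$ with $\alpha\circ f=g\circ\mathsf{F}(\alpha)$. It is an abelian category with enough projectives, and exactness is computed in $\mathcal{B}$. $\mathbb{L}_1\mathsf{F}$ is the first left derived functor of $\mathsf{F}$. For $X\in\mathcal{B}$, $\mathsf{T}(X)=\left(X\oplus\mathsf{F}(X),\left(\begin{smallmatrix}0&0\\1&0\end{smallmatrix}\right)\right)$, the matrix being a morphism $\mathsf{F}(X)\oplus\mathsf{F}^2(X)\to X\oplus\mathsf{F}(X)$; $\mathsf{T}(\mathcal{C})$ is the class of objects isomorphic to $\mathsf{T}(X)$ with $X\in\mathcal{C}$. $\mathsf{U}^{-1}(\mathcal{S})=\{(X,f) : X\in\mathcal{S}\}$. In an abelian category $\mathcal{A}$, a pair $(\mathcal{C},\mathcal{D})$ of classes is a cotorsion pair if $\mathcal{C}=\{C:\mathrm{Ext}^1_{\mathcal{A}}(C,D)=0\ \forall D\in\mathcal{D}\}$ and $\mathcal{D}=\{D:\mathrm{Ext}^1_{\mathcal{A}}(C,D)=0\ \forall C\in\mathcal{C}\}$; it is complete if for every object $A$ there are exact sequences $0\to D\to C\to A\to0$ and $0\to A\to D'\to C'\to0$ with $C,C'\in\mathcal{C}$, $D,D'\in\mathcal{D}$;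 it is hereditary if $\mathrm{Ext}^i_{\mathcal{A}}(C,D)=0$ for all $i\ge1$, $C\in\mathcal{C}$, $D\in\mathcal{D}$. A hereditary Hovey triple in $\mathcal{A}$ is a triple $(\mathcal{C},\mathcal{F},\mathcal{W})$ of classes of objects such that $(\mathcal{C}\cap\mathcal{W},\mathcal{F})$ and $(\mathcal{C},\mathcal{F}\cap\mathcal{W})$ are hereditary complete cotorsion pairs and $\mathcal{W}$ is thick (closed under direct summands, and if two of the three terms of a short exact sequence are in $\mathcal{W}$, so is the third). Its homotopy category $\mathrm{Ho}(\mathcal{M})$ is the localization of $\mathcal{A}$ at the class of weak equivalences, i.e. the composites $p\circ i$ with $i$ a monomorphism with $\mathrm{Coker}(i)\in\mathcal{C}\cap\mathcal{W}$ and $p$ an epimorphism with $\mathrm{Ker}(p)\in\mathcal{F}\cap\mathcal{W}$. It is a triangulated category: $\mathcal{C}\cap\mathcal{F}$ is a Frobenius exact category with projective-injective objects $\mathcal{C}\cap\mathcal{F}\cap\mathcal{W}$, and $\mathcal{C}\cap\mathcal{F}\hookrightarrow\mathcal{A}\to\mathrm{Ho}(\mathcal{M})$ induces a triangle equivalence from the stable category $(\mathcal{C}\cap\mathcal{F})/(\mathcal{C}\cap\mathcal{F}\cap\mathcal{W})$ to $\mathrm{Ho}(\mathcal{M})$. *)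

(* Defs.v *)
From HB Require Import structures.
From mathcomp Require Import all_boot all_order all_algebra.
From mathcomp Require Import boolp classical_sets.
Set Implicit Arguments.
Unset Strict Implicit.
Unset Printing Implicit Defensive.
Import GRing.Theory.
Local Open Scope ring_scope.
Local Open Scope classical_set_scope.

Record preadditive := Preadditive {
  ob :> Type;
  hom : ob -> ob -> zmodType;
  idm : forall X, hom X X;
  comp : forall X Y Z, hom Y Z -> hom X Y -> hom X Z;
  compA : forall X Y Z T (h : hom Z T) (g : hom Y Z) (f : hom X Y),
    comp h (comp g f) = comp (comp h g) f;
  comp1m : forall X Y (f : hom X Y), comp (idm Y) f = f;
  compm1 : forall X Y (f : hom X Y), comp f (idm X) = f;
  compDl : forall X Y Z (g g' : hom Y Z) (f : hom X Y),
    comp (g + g') f = comp g f + comp g' f;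
  compDr : forall X Y Z (g : hom Y Z) (f f' : hom X Y),
    comp g (f + f') = comp g f + comp g f'
}.
Arguments idm {p} X.

Notation "g ∘ f" := (comp g f) (at level 40, left associativity).

Section PreadditiveTheory.
Variable A : preadditive.

Lemma comp0m (X Y Z : A) (f : hom X Y) : (0 : hom Y Z) ∘ f = 0.
Proof. by apply: (addrI (0 ∘ f)); rewrite -compDl !addr0. Qed.

Lemma compm0 (X Y Z : A) (g : hom Y Z) : g ∘ (0 : hom X Y) = 0.
Proof. by apply: (addrI (g ∘ 0)); rewrite -compDr !addr0. Qed.

Lemma compNm (X Y Z : A) (g : hom Y Z) (f : hom X Y) : (- g) ∘ f = - (g ∘ f).
Proof. by apply/eqP; rewrite -addr_eq0 -compDl addNr comp0m. Qed.

Lemma compmN (X Y Z : A) (g : hom Y Z) (f : hom X Y) : g ∘ (- f) = - (g ∘ f).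
Proof. by apply/eqP; rewrite -addr_eq0 -compDr addNr compm0. Qed.

End PreadditiveTheory.

Section Notions.
Variable A : preadditive.
Implicit Types X Y Z : A.

Definition is_zero_ob X :=
  forall Y, (forall f : hom X Y, f = 0) /\ (forall f : hom Y X, f = 0).

Definition is_iso X Y (f : hom X Y) :=
  exists g : hom Y X, g ∘ f = idm X /\ f ∘ g = idm Y.

Definition isomorphic X Y := exists f : hom X Y, is_iso f.

Definition is_mono X Y (f : hom X Y) :=
  forall T (g h : hom T X), f ∘ g = f ∘ h -> g = h.

Definition is_epi X Y (f : hom X Y) :=
  forall T (g h : hom Y T), g ∘ f = h ∘ f -> g = h.

Definition is_kernel X Y Z (g : hom Y Z) (k : hom X Y) :=
  g ∘ k = 0 /\
  forall T (t : hom T Y), g ∘ t = 0 -> exists! h : hom T X, k ∘ h = t.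

Definition is_cokernel X Y Z (f : hom X Y) (q : hom Y Z) :=
  q ∘ f = 0 /\
  forall T (t : hom Y T), t ∘ f = 0 -> exists! h : hom Z T, h ∘ q = t.

Definition is_pushout X Y Y' Z (a : hom X Y) (b : hom X Y')
    (c : hom Y Z) (d : hom Y' Z) :=
  c ∘ a = d ∘ b /\
  forall T (s : hom Y T) (t : hom Y' T), s ∘ a = t ∘ b ->
    exists! h : hom Z T, h ∘ c = s /\ h ∘ d = t.

Record biproduct X Y := Biproduct {
  bp :> A;
  in1 : hom X bp;
  in2 : hom Y bp;
  pr1 : hom bp X;
  pr2 : hom bp Y;
  pr1_in1 : pr1 ∘ in1 = idm X;
  pr2_in2 : pr2 ∘ in2 = idm Y;
  pr1_in2 : pr1 ∘ in2 = 0;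
  pr2_in1 : pr2 ∘ in1 = 0;
  in_pr : in1 ∘ pr1 + in2 ∘ pr2 = idm bp
}.

Definition short_exact X Y Z (i : hom X Y) (p : hom Y Z) :=
  is_kernel p i /\ is_cokernel i p.

(* The image of f is the kernel of g. *)
Definition exact X Y Z (f : hom X Y) (g : hom Y Z) :=
  exists K (k : hom K Y) (e : hom X K),
    [/\ is_kernel g k, is_epi e & f = k ∘ e].

Definition projective P :=
  forall X Y (p : hom X Y) (f : hom P Y), is_epi p -> exists g, p ∘ g = f.

Definition injective_ob I :=
  forall X Y (i : hom X Y) (f : hom X I), is_mono i -> exists g, g ∘ i = f.

Definition enough_projectives :=
  forall X, exists P (p : hom P X), projective P /\ is_epi p.

Definition enough_injectives :=
  forall X, exists I (i : hom X I), injective_ob I /\ is_mono i.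

End Notions.

Record abelian := Abelian {
  ab_cat :> preadditive;
  has_zero : exists Z : ab_cat, is_zero_ob Z;
  biprod : forall X Y : ab_cat, biproduct X Y;
  has_kernels : forall (X Y : ab_cat) (f : hom X Y),
    exists K (k : hom K X), is_kernel f k;
  has_cokernels : forall (X Y : ab_cat) (f : hom X Y),
    exists Q (q : hom Y Q), is_cokernel f q;
  mono_normal : forall (X Y : ab_cat) (f : hom X Y), is_mono f ->
    exists Z (g : hom Y Z), is_kernel g f;
  epi_normal : forall (X Y : ab_cat) (f : hom X Y), is_epi f ->
    exists Z (g : hom Z X), is_cokernel g f
}.

Record add_functor (A B : preadditive) := AddFunctor {
  fob :> A -> B;
  fmap : forall X Y : A, hom X Y -> hom (fob X) (fob Y);
  fmap1 : forall X, fmap (idm X) = idm (fob X);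
  fmap_comp : forall X Y Z (g : hom Y Z) (f : hom X Y),
    fmap (g ∘ f) = fmap g ∘ fmap f;
  fmapD : forall X Y (f g : hom X Y), fmap (f + g) = fmap f + fmap g
}.

(* X -> Y -> Z -> 0 is exact exactly when Y -> Z is a cokernel of X -> Y. *)
Definition right_exact (A B : preadditive) (F : add_functor A B) :=
  forall X Y Z (f : hom X Y) (q : hom Y Z),
    is_cokernel f q -> is_cokernel (fmap F f) (fmap F q).

Record proj_resolution (A : preadditive) (X : A) := ProjResolution {
  res :> nat -> A;
  dif : forall n, hom (res n.+1) (res n);
  aug : hom (res 0%N) X;
  res_proj : forall n, projective (res n);
  aug_epi : is_epi aug;
  aug_exact : exact (dif 0) aug;
  dif_exact : forall n, exact (dif n.+1) (dif n)
}.

Definition is_homology (A : preadditive) (X Y Z : A)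
    (f : hom X Y) (g : hom Y Z) (H : A) :=
  exists K (k : hom K Y) (e : hom X K) (q : hom K H),
    [/\ is_kernel g k, f = k ∘ e & is_cokernel e q].

(* H is a value of the first left derived functor of F at X. *)
Definition is_L1 (A B : preadditive) (F : add_functor A B) (X : A) (H : B) :=
  exists P : proj_resolution X, is_homology (fmap F (dif P 1)) (fmap F (dif P 0)) H.

Definition L1_zero (A B : preadditive) (F : add_functor A B) (X : A) :=
  forall H, is_L1 F X H -> is_zero_ob H.

(* ExtS_zero n X Y says that Ext^(n+1)(X, Y), the cohomology in degree n+1 of
   Hom(P, Y) for P a projective resolution of X, vanishes. This does not depend
   on P; it is used only in categories with enough projectives, where P exists. *)
Definition ExtS_zero (A : preadditive) (n : nat) (X Y : A) :=
  forall (P : proj_resolution X) (f : hom (P n.+1) Y),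
    f ∘ dif P n.+1 = 0 -> exists g : hom (P n) Y, g ∘ dif P n = f.

Section Cotorsion.
Variable A : abelian.
Implicit Types C D W : set A.

Definition cotorsion_pair C D :=
  C = [set X | forall Y, D Y -> ExtS_zero 0 X Y] /\
  D = [set Y | forall X, C X -> ExtS_zero 0 X Y].

Definition complete C D := forall X : A,
  (exists Y Z (i : hom Y Z) (p : hom Z X), [/\ short_exact i p, D Y & C Z]) /\
  (exists Y Z (i : hom X Y) (p : hom Y Z), [/\ short_exact i p, D Y & C Z]).

Definition hereditary C D :=
  forall n X Y, C X -> D Y -> ExtS_zero n X Y.

Definition hereditary_complete_cotorsion_pair C D :=
  [/\ cotorsion_pair C D, complete C D & hereditary C D].

Definition thick W :=
  (forall (X Y : A) (S : biproduct X Y), W S -> W X /\ W Y) /\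
  (forall (X Y Z : A) (i : hom X Y) (p : hom Y Z), short_exact i p ->
    [/\ W X -> W Y -> W Z, W X -> W Z -> W Y & W Y -> W Z -> W X]).

End Cotorsion.

Record triple (A : preadditive) := Triple {
  cof : set A;
  fib : set A;
  triv : set A
}.

Definition hereditary_Hovey_triple (A : abelian) (M : triple A) :=
  [/\ @hereditary_complete_cotorsion_pair A (cof M `&` triv M) (fib M),
      @hereditary_complete_cotorsion_pair A (cof M) (fib M `&` triv M)
    & @thick A (triv M)].

Definition weak_equivalence (A : preadditive) (M : triple A)
    (X Y : A) (f : hom X Y) :=
  exists Z (i : hom X Z) (p : hom Z Y),
    [/\ f = p ∘ i,
        is_mono i /\
          (exists Q (q : hom Z Q), is_cokernel i q /\ (cof M `&` triv M) Q)
      & is_epi p /\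
          (exists K (k : hom K Z), is_kernel p k /\ (fib M `&` triv M) K)].

(* Localizations and stable categories are quotients on morphisms: hom-sets
   carry an equivalence relation ≈, which is the equality of the quotient. *)

Record category := Category {
  obj :> Type;
  mor : obj -> obj -> Type;
  meq : forall X Y, mor X Y -> mor X Y -> Prop;
  mid : forall X, mor X X;
  mcomp : forall X Y Z, mor Y Z -> mor X Y -> mor X Z;
  meq_refl : forall X Y (f : mor X Y), meq f f;
  meq_sym : forall X Y (f g : mor X Y), meq f g -> meq g f;
  meq_trans : forall X Y (f g h : mor X Y), meq f g -> meq g h -> meq f h;
  meq_comp : forall X Y Z (g g' : mor Y Z) (f f' : mor X Y),
    meq g g' -> meq f f' -> meq (mcomp g f) (mcomp g' f');
  mcompA : forall X Y Z T (h : mor Z T) (g : mor Y Z) (f : mor X Y),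
    meq (mcomp h (mcomp g f)) (mcomp (mcomp h g) f);
  mcomp1m : forall X Y (f : mor X Y), meq (mcomp (mid Y) f) f;
  mcompm1 : forall X Y (f : mor X Y), meq (mcomp f (mid X)) f
}.
Arguments mid {c} X.

Notation "f ≈ g" := (meq f g) (at level 70, no associativity).
Notation "g ⊙ f" := (mcomp g f) (at level 40, left associativity).

Record functor (S T : category) := Functor {
  onob :> S -> T;
  onmor : forall X Y : S, mor X Y -> mor (onob X) (onob Y);
  onmor_eq : forall X Y (f g : mor X Y), f ≈ g -> onmor f ≈ onmor g;
  onmor1 : forall X, onmor (mid X) ≈ mid (onob X);
  onmor_comp : forall X Y Z (g : mor Y Z) (f : mor X Y),
    onmor (g ⊙ f) ≈ onmor g ⊙ onmor f
}.

Definition is_equiv_mor (T : category) (X Y : T) (f : mor X Y) :=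
  exists g : mor Y X, g ⊙ f ≈ mid X /\ f ⊙ g ≈ mid Y.

Definition functor_id (T : category) : functor T T.
Proof.
by exists id (fun X Y f => f) => // *; exact: meq_refl.
Defined.

Definition functor_comp (S T U : category) (G : functor T U) (F : functor S T) :
  functor S U.
Proof.
exists (fun X => G (F X)) (fun X Y f => onmor G (onmor F f)).
- by move=> X Y f g fg; do 2 apply: onmor_eq.
- by move=> X; apply: meq_trans (onmor1 G _); apply/onmor_eq/onmor1.
- move=> X Y Z g f; apply: meq_trans (onmor_comp G _ _).
  exact/onmor_eq/onmor_comp.
Defined.

Definition is_nat_iso (S T : category) (F G : functor S T)
    (eta : forall X, mor (F X) (G X)) :=
  (forall X, is_equiv_mor (eta X)) /\
  (forall X Y (f : mor X Y), eta Y ⊙ onmor F f ≈ onmor G f ⊙ eta X).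

Definition is_equivalence (S T : category) (G : functor S T) :=
  exists H : functor T S,
    (exists eta, is_nat_iso (F := functor_id S) (G := functor_comp H G) eta) /\
    (exists eps, is_nat_iso (F := functor_comp G H) (G := functor_id T) eps).

(* Formal composites of morphisms and of inverses of elements of w, modulo the
   relations forced by a functor inverting w. *)

Section Localization.
Variables (A : preadditive) (w : forall X Y : A, hom X Y -> Prop).

Inductive zigzag : A -> A -> Type :=
| zz_id X : zigzag X X
| zz_hom X Y of hom X Y : zigzag X Y
| zz_inv X Y (f : hom X Y) of w f : zigzag Y X
| zz_comp X Y Z of zigzag Y Z & zigzag X Y : zigzag X Z.

Inductive zz_eq : forall X Y, zigzag X Y -> zigzag X Y -> Prop :=
| zz_refl X Y (a : zigzag X Y) : zz_eq a a
| zz_sym X Y (a b : zigzag X Y) : zz_eq a b -> zz_eq b a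
| zz_trans X Y (a b c : zigzag X Y) : zz_eq a b -> zz_eq b c -> zz_eq a c
| zz_cong X Y Z (b b' : zigzag Y Z) (a a' : zigzag X Y) :
    zz_eq b b' -> zz_eq a a' -> zz_eq (zz_comp b a) (zz_comp b' a')
| zz_assoc X Y Z T (c : zigzag Z T) (b : zigzag Y Z) (a : zigzag X Y) :
    zz_eq (zz_comp c (zz_comp b a)) (zz_comp (zz_comp c b) a)
| zz_idl X Y (a : zigzag X Y) : zz_eq (zz_comp (zz_id Y) a) a
| zz_idr X Y (a : zigzag X Y) : zz_eq (zz_comp a (zz_id X)) a
| zz_hom_id X : zz_eq (zz_hom (idm X)) (zz_id X)
| zz_hom_comp X Y Z (g : hom Y Z) (f : hom X Y) :
    zz_eq (zz_hom (g ∘ f)) (zz_comp (zz_hom g) (zz_hom f))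
| zz_invl X Y (f : hom X Y) (wf : w f) :
    zz_eq (zz_comp (zz_inv wf) (zz_hom f)) (zz_id X)
| zz_invr X Y (f : hom X Y) (wf : w f) :
    zz_eq (zz_comp (zz_hom f) (zz_inv wf)) (zz_id Y).

Definition localization : category :=
  @Category A zigzag zz_eq zz_id zz_comp
    zz_refl zz_sym zz_trans zz_cong zz_assoc zz_idl zz_idr.

End Localization.

Definition Ho (A : preadditive) (M : triple A) : category :=
  localization (@weak_equivalence A M).

Section Stable.
Variables (A : preadditive) (M : triple A).

Definition bifibrant := {X : A | (cof M `&` fib M) X}.

Definition proj_inj : set A := cof M `&` fib M `&` triv M.

(* The ideal generated by the identities of the objects in proj_inj. One
   summand suffices if proj_inj is closed under biproducts, which holds for
   Hovey triples. *)
Inductive factors (X Y : A) : hom X Y -> Prop :=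
| factors0 : factors 0
| factorsD Z (a : hom X Z) (b : hom Z Y) (f : hom X Y) :
    proj_inj Z -> factors f -> factors (b ∘ a + f).

Lemma factors_add (X Y : A) (f g : hom X Y) :
  factors f -> factors g -> factors (f + g).
Proof.
by elim=> [|Z a b h IZ _ IH] fg; rewrite ?add0r // -addrA; constructor=> //; exact: IH.
Qed.

Lemma factors_compl (X Y Z : A) (g : hom Y Z) (f : hom X Y) :
  factors f -> factors (g ∘ f).
Proof.
by elim=> [|T a b h IT _ IH]; rewrite ?compm0 ?compDr ?compA; constructor.
Qed.

Lemma factors_compr (X Y Z : A) (g : hom Y Z) (f : hom X Y) :
  factors g -> factors (g ∘ f).
Proof.
by elim=> [|T a b h IT _ IH]; rewrite ?comp0m ?compDl -?compA; constructor.
Qed.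

Lemma factors_opp (X Y : A) (f : hom X Y) : factors f -> factors (- f).
Proof. by rewrite -{2}[f]comp1m -compNm; exact: factors_compl. Qed.

Definition stable_eq (X Y : A) (f g : hom X Y) := factors (f - g).

Definition stable : category.
Proof.
exists bifibrant (fun X Y => hom (sval X) (sval Y) : Type)
  (fun X Y => @stable_eq (sval X) (sval Y)) (fun X => idm (sval X))
  (fun X Y Z => @comp A (sval X) (sval Y) (sval Z)); rewrite /stable_eq.
- by move=> *; rewrite subrr; constructor.
- by move=> X Y f g /factors_opp; rewrite opprB.
- move=> X Y f g h fg gh; rewrite -(subrK g f) -addrA; exact: factors_add.
- move=> X Y Z g g' f f' gg ff.
  have -> : g ∘ f - g' ∘ f' = (g - g') ∘ f + g' ∘ (f - f').
    by rewrite compDl compDr compNm compmN addrA subrK.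
  by apply: factors_add; [exact: factors_compr | exact: factors_compl].
- by move=> *; rewrite compA subrr; constructor.
- by move=> *; rewrite comp1m subrr; constructor.
- by move=> *; rewrite compm1 subrr; constructor.
Defined.

(* The functor induced by A -> Ho M once it is known to respect stable
   equality. *)
Definition respects_stable_eq := forall (X Y : stable) (f g : hom (sval X) (sval Y)),
  stable_eq f g -> zz_eq (zz_hom (@weak_equivalence A M) f) (zz_hom _ g).

Definition stable_to_Ho (wd : respects_stable_eq) : functor stable (Ho M).
Proof.
exists (fun X : stable => sval X : Ho M)
  (fun (X Y : stable) f => zz_hom (@weak_equivalence A M) f) => //.
- by move=> X; exact: zz_hom_id.
- by move=> X Y Z g f; exact: zz_hom_comp.
Defined.

End Stable.

(* A tri_structure is a shift functor with a class of distinguished triangles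
   closed under isomorphism. Verdier's axioms are not part of the record: it is
   used for the stable category, where they hold by Happel's theorem, and for
   structures transported from there along an equivalence. *)

Record triangle (T : category) (S : functor T T) := Triangle {
  v1 : T;
  v2 : T;
  v3 : T;
  m1 : mor v1 v2;
  m2 : mor v2 v3;
  m3 : mor v3 (S v1)
}.

Definition tri_iso (T : category) (S : functor T T) (t t' : triangle S) :=
  exists (a : mor (v1 t) (v1 t')) (b : mor (v2 t) (v2 t')) (c : mor (v3 t) (v3 t')),
    [/\ is_equiv_mor a, is_equiv_mor b & is_equiv_mor c] /\
    [/\ b ⊙ m1 t ≈ m1 t' ⊙ a, c ⊙ m2 t ≈ m2 t' ⊙ b
      & onmor S a ⊙ m3 t ≈ m3 t' ⊙ c].

Record tri_structure (T : category) := TriStructure {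
  shift : functor T T;
  distinguished : triangle shift -> Prop;
  distinguished_iso : forall t t', tri_iso t t' ->
    distinguished t -> distinguished t'
}.

Definition map_triangle (T T' : category) (G : functor T T')
    (S : functor T T) (S' : functor T' T')
    (xi : forall X, mor (G (S X)) (S' (G X))) (t : triangle S) : triangle S' :=
  Triangle (onmor G (m1 t)) (onmor G (m2 t)) (xi (v1 t) ⊙ onmor G (m3 t)).

(* For triangulated categories, an equivalence commuting with the shifts and
   preserving distinguished triangles also reflects them. *)
Definition triangle_equivalence (T T' : category)
    (D : tri_structure T) (D' : tri_structure T') (G : functor T T') :=
  is_equivalence G /\
  exists xi, is_nat_iso (F := functor_comp G (shift D))
                        (G := functor_comp (shift D') G) xi /\
    forall t, distinguished t <-> distinguished (map_triangle xi t).

Lemma tri_iso_trans (T : category) (S : functor T T) (t t' t'' : triangle S) :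
  tri_iso t t' -> tri_iso t' t'' -> tri_iso t t''.
Proof.
have iso_comp (X Y Z : T) (g : mor Y Z) (f : mor X Y) :
    is_equiv_mor g -> is_equiv_mor f -> is_equiv_mor (g ⊙ f).
  have cancel (U V W : T) (p : mor V W) (q : mor U V) (q' : mor V U) (p' : mor W V) :
      p' ⊙ p ≈ mid V -> q' ⊙ q ≈ mid U -> (q' ⊙ p') ⊙ (p ⊙ q) ≈ mid U.
    move=> pp qq; apply: meq_trans qq; apply: meq_trans (mcompA _ _ _) _.
    apply: meq_comp (meq_refl _); apply: meq_trans (meq_sym (mcompA _ _ _)) _.
    by apply: meq_trans (mcompm1 _); apply: meq_comp pp; exact: meq_refl.
  by move=> [g' [? ?]] [f' [? ?]]; exists (f' ⊙ g'); split; exact: cancel.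
have square (X Y Z X' Y' Z' : T) (f : mor X X') (f' : mor Y Y') (f'' : mor Z Z')
    (p : mor X Y) (p' : mor X' Y') (q : mor Y Z) (q' : mor Y' Z') :
    p' ⊙ f ≈ f' ⊙ p -> q' ⊙ f' ≈ f'' ⊙ q -> (q' ⊙ p') ⊙ f ≈ f'' ⊙ (q ⊙ p).
  move=> pf qf; apply: meq_trans (meq_sym (mcompA _ _ _)) _.
  apply: meq_trans (meq_comp (meq_refl _) pf) _.
  apply: meq_trans (mcompA _ _ _) _; apply: meq_trans (meq_sym (mcompA _ _ _)).
  exact: meq_comp (meq_refl _).
move=> [a [b [c [[ia ib ic] [s1 s2 s3]]]]] [a' [b' [c' [[ia' ib' ic'] [s1' s2' s3']]]]].
exists (a' ⊙ a), (b' ⊙ b), (c' ⊙ c); split; split; try exact: iso_comp.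
- exact: square s1 s1'.
- exact: square s2 s2'.
apply: meq_trans (square _ _ _ _ _ _ _ _ _ _ _ _ _ s3 s3').
exact: meq_comp (onmor_comp _ _ _) (meq_refl _).
Qed.

Section StableTriangles.
Variables (A : preadditive) (M : triple A).

(* A suspension functor on the stable category: S X is the cokernel of a chosen
   monomorphism from X to a projective-injective object, and S f is induced by
   an extension of f to these objects. *)
Record suspension := Suspension {
  susp :> functor (stable M) (stable M);
  hull : stable M -> A;
  hull_in : forall X, hom (sval X) (hull X);
  hull_pr : forall X, hom (hull X) (sval (susp X));
  hull_proj_inj : forall X, proj_inj M (hull X);
  hull_exact : forall X, short_exact (hull_in X) (hull_pr X);
  susp_induced : forall (X Y : stable M) (f : hom (sval X) (sval Y)),
    exists (g : hom (hull X) (hull Y)) (h : hom (sval (susp X)) (sval (susp Y))),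
      [/\ g ∘ hull_in X = hull_in Y ∘ f,
          h ∘ hull_pr X = hull_pr Y ∘ g
        & stable_eq M (onmor susp (f : mor X Y)) h]
}.

(* Happel's standard triangle on a morphism X -> Y of A: its third vertex is
   the pushout of the hull of X along it. *)
Definition standard_triangle (S : suspension) (t : triangle S) :=
  exists j : hom (hull S (v1 t)) (sval (v3 t)),
    [/\ is_pushout (hull_in S (v1 t)) (m1 t : hom _ _) j (m2 t : hom _ _),
        (m3 t : hom _ _) ∘ (m2 t : hom _ _) = 0
      & (m3 t : hom _ _) ∘ j = hull_pr S (v1 t)].

Definition stable_tri (S : suspension) : tri_structure (stable M).
Proof.
exists S (fun t => exists2 t0, standard_triangle t0 & tri_iso t0 t).
by move=> t t' tt' [t0 st0 t0t]; exists t0 => //; exact: tri_iso_trans t0t tt'.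
Defined.

(* The structure of Ho M for which the functor induced by
   cof ∩ fib -> A -> Ho M is a triangle equivalence. For a hereditary Hovey
   triple it exists; since distinguished triangles are closed under isomorphism,
   it is unique up to isomorphism of the shift functor. *)
Definition is_Ho_tri (D : tri_structure (Ho M)) :=
  exists (S : suspension) (wd : respects_stable_eq M),
    triangle_equivalence (stable_tri S) D (stable_to_Ho wd).

End StableTriangles.

Section TrivialExtension.
Variables (B : abelian) (F : add_functor B B).

Record rtriv_ob := RtrivOb {
  under : B;
  act : hom (F under) under;
  act_act : act ∘ fmap F act = 0
}.

Definition rtriv_pred (X Y : rtriv_ob) : {pred hom (under X) (under Y)} :=
  fun a => a ∘ act X == act Y ∘ fmap F a.
Arguments rtriv_pred : clear implicits.

Lemma fmap0 (X Y : B) : fmap F (0 : hom X Y) = 0.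
Proof. by apply: (addrI (fmap F 0)); rewrite -fmapD !addr0. Qed.

Lemma fmapN (X Y : B) (f : hom X Y) : fmap F (- f) = - fmap F f.
Proof. by apply/eqP; rewrite -addr_eq0 -fmapD addNr fmap0. Qed.

Fact rtriv_pred_zmod (X Y : rtriv_ob) : zmod_closed (rtriv_pred X Y).
Proof.
split=> [|a b /eqP aP /eqP bP]; apply/eqP; first by rewrite fmap0 compm0 comp0m.
by rewrite fmapD fmapN compDl compDr compNm compmN aP bP.
Qed.
HB.instance Definition _ X Y :=
  GRing.isZmodClosed.Build _ (rtriv_pred X Y) (rtriv_pred_zmod X Y).

Record rtriv_hom (X Y : rtriv_ob) := RtrivHom {
  thom : hom (under X) (under Y);
  thomP : thom \in rtriv_pred X Y
}.
HB.instance Definition _ X Y := [isSub for @thom X Y].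
HB.instance Definition _ X Y := [Choice of rtriv_hom X Y by <:].
HB.instance Definition _ X Y := [SubChoice_isSubZmodule of rtriv_hom X Y by <:].

Lemma thomE X Y (a : rtriv_hom X Y) : thom a ∘ act X = act Y ∘ fmap F (thom a).
Proof. by case: a => a /= /eqP. Qed.

Definition rtriv_mk X Y (a : hom (under X) (under Y))
  (e : a ∘ act X = act Y ∘ fmap F a) : rtriv_hom X Y := RtrivHom (introT eqP e).

Lemma thom_inj X Y : injective (@thom X Y).
Proof. exact: val_inj. Qed.

Lemma thom0 X Y : thom (0 : rtriv_hom X Y) = 0.
Proof. by rewrite -[thom _]/(val _) raddf0. Qed.

Lemma thomD X Y (a b : rtriv_hom X Y) : thom (a + b) = thom a + thom b.
Proof. by rewrite -[thom _]/(val _) raddfD. Qed.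

Fact rtriv_id_subproof X : idm (under X) ∘ act X = act X ∘ fmap F (idm (under X)).
Proof. by rewrite fmap1 comp1m compm1. Qed.

Fact rtriv_comp_subproof X Y Z (b : rtriv_hom Y Z) (a : rtriv_hom X Y) :
  thom b ∘ thom a ∘ act X = act Z ∘ fmap F (thom b ∘ thom a).
Proof. by rewrite fmap_comp -compA thomE compA thomE compA. Qed.

Definition rtriv_pre : preadditive.
Proof.
exists rtriv_ob (fun X Y => rtriv_hom X Y : zmodType)
  (fun X => rtriv_mk (rtriv_id_subproof X))
  (fun X Y Z b a => rtriv_mk (rtriv_comp_subproof b a)).
- by move=> *; apply: thom_inj; exact: compA.
- by move=> *; apply: thom_inj; exact: comp1m.
- by move=> *; apply: thom_inj; exact: compm1.
- move=> X Y Z g g' f; apply: thom_inj; apply: etrans (esym (thomD _ _)).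
  exact: etrans (congr1 (fun a => a ∘ thom f) (thomD _ _)) (compDl _ _ _).
- move=> X Y Z g f f'; apply: thom_inj; apply: etrans (esym (thomD _ _)).
  exact: etrans (congr1 (comp (thom g)) (thomD _ _)) (compDr _ _ _).
Defined.

Lemma kernel_mono (A : preadditive) (X Y Z : A) (g : hom Y Z) (k : hom X Y) :
  is_kernel g k -> is_mono k.
Proof.
move=> [gk kP] T a b ab; have [|h [_ hP]] := kP _ (k ∘ a); first by rewrite compA gk comp0m.
by rewrite -(hP a) // -(hP b).
Qed.

Lemma cokernel_epi (A : preadditive) (X Y Z : A) (f : hom X Y) (q : hom Y Z) :
  is_cokernel f q -> is_epi q.
Proof.
move=> [qf qP] T a b ab; have [|h [_ hP]] := qP _ (a ∘ q); first by rewrite -compA qf compm0.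
by rewrite -(hP a) // -(hP b).
Qed.

Lemma mono0 (A : preadditive) (X Y : A) (f : hom X Y) :
  (forall T (g : hom T X), f ∘ g = 0 -> g = 0) -> is_mono f.
Proof.
move=> f0 T g h gh; apply/eqP; rewrite -subr_eq0; apply/eqP/f0.
by rewrite compDr compmN gh subrr.
Qed.

Lemma epi0 (A : preadditive) (X Y : A) (f : hom X Y) :
  (forall T (g : hom Y T), g ∘ f = 0 -> g = 0) -> is_epi f.
Proof.
move=> f0 T g h gh; apply/eqP; rewrite -subr_eq0; apply/eqP/f0.
by rewrite compDl compNm gh subrr.
Qed.

Lemma mono_ker_coker (A : abelian) (X Y Z : A) (f : hom X Y) (q : hom Y Z) :
  is_mono f -> is_cokernel f q -> is_kernel q f.
Proof.
move=> /mono_normal[T [g [gf fP]]] [qf qP]; split=> // U t qt.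
have [h [hq _]] := qP _ g gf; apply: fP.
by rewrite -hq -compA qt compm0.
Qed.

Lemma epi_coker_ker (A : abelian) (X Y Z : A) (f : hom X Y) (k : hom Z X) :
  is_epi f -> is_kernel f k -> is_cokernel k f.
Proof.
move=> /epi_normal[T [g [fg gP]]] [fk kP]; split=> // U t tk.
have [h [kh _]] := kP _ g fg; apply: gP.
by rewrite -kh compA tk comp0m.
Qed.

Lemma rtriv_ker X Y Z (b : rtriv_hom Y Z) (a : rtriv_hom X Y) :
  is_kernel (thom b) (thom a) -> @is_kernel rtriv_pre X Y Z b a.
Proof.
move=> bk; have am := kernel_mono bk; case: bk => ba aP; split.
  by apply: thom_inj; rewrite thom0.
move=> T t bt.
have [h [ah hP]] := aP _ (thom t) (etrans (congr1 (@thom _ _) bt) (thom0 _ _)).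
have eh : h ∘ act T = act X ∘ fmap F h.
  by apply: am; rewrite compA ah thomE compA thomE -compA -fmap_comp ah.
exists (rtriv_mk eh); split; first exact: thom_inj.
by move=> h' ah'; apply: thom_inj; apply: hP; rewrite -ah'.
Qed.

Hypothesis rexF : right_exact F.

Lemma rtriv_coker X Y Z (a : rtriv_hom X Y) (b : rtriv_hom Y Z) :
  is_cokernel (thom a) (thom b) -> @is_cokernel rtriv_pre X Y Z a b.
Proof.
move=> bc; have Fb := cokernel_epi (rexF bc); case: bc => ba bP; split.
  by apply: thom_inj; rewrite thom0.
move=> T t ta.
have [h [hb hP]] := bP _ (thom t) (etrans (congr1 (@thom _ _) ta) (thom0 _ _)).
have eh : h ∘ act Z = act T ∘ fmap F h.
  by apply: Fb; rewrite -compA -thomE compA hb thomE -compA -fmap_comp hb.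
exists (rtriv_mk eh); split; first exact: thom_inj.
by move=> h' hb'; apply: thom_inj; apply: hP; rewrite -hb'.
Qed.

Lemma rtriv_has_ker X Y (a : rtriv_hom X Y) :
  exists K (k : rtriv_hom K X), is_kernel (thom a) (thom k).
Proof.
have [K [k kk]] := has_kernels (thom a).
have km := kernel_mono kk; have [ak kP] := kk.
have [|f [kf _]] := kP _ (act X ∘ fmap F k).
  by rewrite compA thomE -compA -fmap_comp ak fmap0 compm0.
have ff : f ∘ fmap F f = 0.
  apply: km; rewrite compA kf -compA -fmap_comp kf fmap_comp compA act_act.
  by rewrite comp0m compm0.
by exists (RtrivOb ff), (@rtriv_mk (RtrivOb ff) X k kf).
Qed.

Lemma rtriv_has_coker X Y (a : rtriv_hom X Y) :
  exists Q (q : rtriv_hom Y Q), is_cokernel (thom a) (thom q).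
Proof.
have [Q [q qq]] := has_cokernels (thom a).
have qa := proj1 qq; have [Fqa FqP] := rexF qq.
have FFq := cokernel_epi (rexF (rexF qq)).
have [|g [gq _]] := FqP _ (q ∘ act Y).
  by rewrite -compA -thomE compA qa comp0m.
have gg : g ∘ fmap F g = 0.
  apply: FFq; rewrite -compA -fmap_comp gq fmap_comp compA gq -compA act_act.
  by rewrite comp0m compm0.
by exists (RtrivOb gg), (@rtriv_mk Y (RtrivOb gg) q (esym gq)).
Qed.

Lemma rtriv_mono X Y (a : rtriv_hom X Y) :
  @is_mono rtriv_pre X Y a -> is_mono (thom a).
Proof.
move=> am; have [K [k [ak kP]]] := rtriv_has_ker a.
have k0 : k = 0.
  apply: (am K); rewrite compm0; apply: thom_inj.
  exact: etrans ak (esym (thom0 _ _)).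
apply: mono0 => T g ag; have [h [<- _]] := kP _ g ag.
by rewrite k0 thom0 comp0m.
Qed.

Lemma rtriv_epi X Y (a : rtriv_hom X Y) :
  @is_epi rtriv_pre X Y a -> is_epi (thom a).
Proof.
move=> ae; have [Q [q [qa qP]]] := rtriv_has_coker a.
have q0 : q = 0.
  apply: (ae Q); rewrite comp0m; apply: thom_inj.
  exact: etrans qa (esym (thom0 _ _)).
apply: epi0 => T g ga; have [h [<- _]] := qP _ g ga.
by rewrite q0 thom0 compm0.
Qed.

Fact rtriv_zero : exists Z : rtriv_pre, is_zero_ob Z.
Proof.
have [Z ZP] := has_zero B.
have aP : (0 : hom (F Z) Z) ∘ fmap F (0 : hom (F Z) Z) = 0 by exact: comp0m.
exists (RtrivOb aP) => Y.
by split=> f; apply: thom_inj; rewrite thom0; [apply: (proj1 (ZP _)) | apply: (proj2 (ZP _))].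
Qed.

Section Biproduct.
Variables X Y : rtriv_ob.
Let S := biprod (under X) (under Y).
Let s : hom (F S) S :=
  in1 S ∘ act X ∘ fmap F (pr1 S) + in2 S ∘ act Y ∘ fmap F (pr2 S).

Let pr1s : pr1 S ∘ s = act X ∘ fmap F (pr1 S).
Proof. by rewrite compDr !compA pr1_in1 pr1_in2 comp1m !comp0m addr0. Qed.
Let pr2s : pr2 S ∘ s = act Y ∘ fmap F (pr2 S).
Proof. by rewrite compDr !compA pr2_in1 pr2_in2 comp1m !comp0m add0r. Qed.
Let in1s : in1 S ∘ act X = s ∘ fmap F (in1 S).
Proof.
rewrite compDl -!compA -!fmap_comp pr1_in1 pr2_in1 fmap1 fmap0.
by rewrite compm1 !compm0 addr0.
Qed.
Let in2s : in2 S ∘ act Y = s ∘ fmap F (in2 S).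
Proof.
rewrite compDl -!compA -!fmap_comp pr1_in2 pr2_in2 fmap1 fmap0.
by rewrite compm1 !compm0 add0r.
Qed.

Fact rtriv_biprod_subproof : s ∘ fmap F s = 0.
Proof.
rewrite {1}/s compDl -!compA -!fmap_comp pr1s pr2s !fmap_comp.
by rewrite ![act _ ∘ (_ ∘ _)]compA !act_act !comp0m !compm0 addr0.
Qed.

Definition rtriv_biprod : @biproduct rtriv_pre X Y.
Proof.
exists (RtrivOb rtriv_biprod_subproof)
  (@rtriv_mk X (RtrivOb rtriv_biprod_subproof) _ in1s)
  (@rtriv_mk Y (RtrivOb rtriv_biprod_subproof) _ in2s)
  (@rtriv_mk (RtrivOb rtriv_biprod_subproof) X _ pr1s)
  (@rtriv_mk (RtrivOb rtriv_biprod_subproof) Y _ pr2s); apply: thom_inj.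
- exact: pr1_in1.
- exact: pr2_in2.
- by rewrite thom0; exact: pr1_in2.
- by rewrite thom0; exact: pr2_in1.
- by rewrite thomD; exact: in_pr.
Defined.
End Biproduct.

Definition trivial_extension : abelian.
Proof.
exists rtriv_pre.
- exact: rtriv_zero.
- exact: rtriv_biprod.
- by move=> X Y a; have [K [k /rtriv_ker kP]] := rtriv_has_ker a; exists K, k.
- by move=> X Y a; have [Q [q /rtriv_coker qP]] := rtriv_has_coker a; exists Q, q.
- move=> X Y a /rtriv_mono am; have [Q [q qP]] := rtriv_has_coker a.
  by exists Q, q; apply: rtriv_ker; exact: mono_ker_coker.
- move=> X Y a /rtriv_epi ae; have [K [k kP]] := rtriv_has_ker a.
  by exists K, k; apply: rtriv_coker; exact: epi_coker_ker.
Defined.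

(* T X = X ⊕ F X, with structure map F X ⊕ F (F X) -> F X -> X ⊕ F X, the
   projection followed by the second injection. *)
Section T.
Variable X : B.
Let S := biprod X (F X).

Fact T_subproof : in2 S ∘ fmap F (pr1 S) ∘ fmap F (in2 S ∘ fmap F (pr1 S)) = 0.
Proof.
by rewrite -compA -fmap_comp compA pr1_in2 comp0m fmap0 compm0.
Qed.

Definition T : trivial_extension := RtrivOb T_subproof.
End T.

Definition T_class (C : set B) : set trivial_extension :=
  [set Y | exists2 X, C X & isomorphic Y (T X)].

Definition U_preimage (C : set B) : set trivial_extension :=
  [set Y | C (under Y)].

Definition rtriv_triple (M : triple B) : triple trivial_extension :=
  Triple (T_class (cof M)) (U_preimage (fib M)) (U_preimage (triv M)).

Lemma trivial_extension_enough_projectives :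
  enough_projectives B -> enough_projectives trivial_extension.
Proof.
move=> epB X; have [P [p [Pproj pe]]] := epB (under X).
pose S := biprod P (F P).
have lift (Y : rtriv_ob) (g : hom P (under Y)) :
    exists h : rtriv_hom (T P) Y, thom h ∘ in1 S = g.
  have e : (g ∘ pr1 S + act Y ∘ fmap F g ∘ pr2 S) ∘ act (T P) =
           act Y ∘ fmap F (g ∘ pr1 S + act Y ∘ fmap F g ∘ pr2 S).
    rewrite fmapD !fmap_comp compDr compDl -!compA.
    rewrite [pr1 _ ∘ (_ ∘ _)]compA pr1_in2 comp0m compm0 add0r.
    rewrite [pr2 _ ∘ (_ ∘ _)]compA pr2_in2 comp1m.
    by rewrite [act Y ∘ (fmap F (act Y) ∘ _)]compA act_act comp0m addr0.
  exists (rtriv_mk e) => /=.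
  by rewrite compDl -!compA pr1_in1 pr2_in1 compm1 !compm0 addr0.
have uniq (Y : rtriv_ob) (h h' : rtriv_hom (T P) Y) :
    thom h ∘ in1 S = thom h' ∘ in1 S -> h = h'.
  move=> hh; have in2E (l : rtriv_hom (T P) Y) :
      thom l ∘ in2 S = act Y ∘ fmap F (thom l ∘ in1 S).
    rewrite fmap_comp compA -thomE /= -!compA -fmap_comp pr1_in1 fmap1.
    by rewrite compm1.
  apply: thom_inj; rewrite -[thom h]compm1 -[thom h']compm1 -(in_pr S).
  by rewrite !compDr !compA !in2E hh.
have [h hp] := lift X p.
exists (T P), h; split.
  move=> Y Z e f /rtriv_epi ee.
  have [g eg] := Pproj _ _ (thom e) (thom f ∘ in1 S) ee.
  have [l lg] := lift Y g; exists l; apply: uniq.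
  by rewrite -eg -lg compA.
move=> Y a b ab; apply: thom_inj; apply: pe; rewrite -hp !compA.
exact: (congr1 (fun c : rtriv_hom (T P) Y => thom c ∘ in1 S) ab).
Qed.

End TrivialExtension.

(* Main.v *)
From Stdlib Require Import Setoid Morphisms.
Require Import Defs.
From mathcomp Require Import all_boot all_order all_algebra.
From mathcomp Require Import boolp classical_sets.
(* all_algebra shadows [hom] and [comp]. *)
Import Defs.
Set Implicit Arguments.
Unset Strict Implicit.
Unset Printing Implicit Defensive.
Import GRing.Theory.
Local Open Scope ring_scope.
Local Open Scope classical_set_scope.

(* Write T X = X ⊕ F X for the left adjoint of the forgetful functor U. Since
   Hom (T X, Y) = Hom (X, U Y), extensions of T X by Y split as soon as
   extensions of X by U Y do. The condition L1 F = 0 on cof M makes T exact on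
   short exact sequences ending in cof M; covers and envelopes in the trivial
   extension are then obtained from those in B, using F (cof M) ⊆ fib M ∩ triv M
   to keep kernels and pushouts in the right class. The remaining point is that
   T (cof M) is closed under retracts: because F ∘ F = 0, an object Y is
   isomorphic to T (coker (act Y)) as soon as act Y is mono and its cokernel is
   split.

   For the homotopy categories it is enough to compare the stable categories of
   bifibrant objects. T induces a functor between them whose inverse is induced
   by Y ↦ coker (act Y): a map X → F Y extends to the hull of X because
   F Y ∈ fib M ∩ triv M, so a map T X → T Y is stably T of its diagonal part.
   Both functors are left adjoints, so they preserve the pushouts that define
   standard triangles, and they preserve the hulls that define the shift. *)

(** * Preadditive and abelian categories *)

(** The statement quantifies over choices: vanishing of Ext is tested on every projective
    resolution, and a homotopy category has its triangles only through some suspension. The first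
    difficulty is met by turning Ext^1 into an extension property for short exact sequences
    ([ext1P]) and higher Ext into Ext of syzygies; the second by showing that shifts and cones built
    from different hulls are stably isomorphic. Nothing is computed inside the localizations: [Ho]
    enters only through its given equivalence with a stable category. The final functor comes from
    [stable M] → [stable ME] → [Ho ME], inverted, followed by [stable M] → [Ho M], where [ME] is the
    triple on the trivial extension. Since [tri_structure] does not contain Verdier's axioms,
    reflection of distinguished triangles has to be proved. It follows by applying the
    quasi-inverse, which preserves them too, and comparing along the unit. Objects have no elements,
    so diagram chases use maps from test objects, which lift through an epimorphism after
    precomposition with another one. *)

Section Preadditive.
Variable A : preadditive.
Implicit Types X Y Z : A.

Lemma comp_eq X Y Z W (g : hom Y Z) (f : hom X Y) h (x : hom Z W) :
  g ∘ f = h -> x ∘ g ∘ f = x ∘ h.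
Proof. by move=> <-; rewrite compA. Qed.

Lemma comp_0 X Y Z W (g : hom Y Z) (f : hom X Y) (x : hom Z W) :
  g ∘ f = 0 -> x ∘ g ∘ f = 0.
Proof. by move=> /comp_eq->; rewrite compm0. Qed.

Lemma comp_1 X Y W (g : hom Y X) (f : hom X Y) (x : hom X W) :
  g ∘ f = idm X -> x ∘ g ∘ f = x.
Proof. by move=> /comp_eq->; rewrite compm1. Qed.

Lemma monoP X Y T (f : hom X Y) (g : hom T X) : is_mono f -> f ∘ g = 0 -> g = 0.
Proof. by move=> fm fg; apply: fm; rewrite fg compm0. Qed.

Lemma epiP X Y T (f : hom X Y) (g : hom Y T) : is_epi f -> g ∘ f = 0 -> g = 0.
Proof. by move=> fe gf; apply: fe; rewrite gf comp0m. Qed.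

Lemma mono_comp X Y Z (g : hom Y Z) (f : hom X Y) :
  is_mono g -> is_mono f -> is_mono (g ∘ f).
Proof. by move=> gm fm; apply: mono0 => T h; rewrite -compA => /(monoP gm)/(monoP fm). Qed.

Lemma epi_comp X Y Z (g : hom Y Z) (f : hom X Y) :
  is_epi g -> is_epi f -> is_epi (g ∘ f).
Proof. by move=> ge fe; apply: epi0 => T h; rewrite compA => /(epiP fe)/(epiP ge). Qed.

Lemma mono_of_comp X Y Z (g : hom Y Z) (f : hom X Y) : is_mono (g ∘ f) -> is_mono f.
Proof. by move=> gfm; apply: mono0 => T h fh; apply: (monoP gfm); rewrite -compA fh compm0. Qed.

Lemma epi_of_comp X Y Z (g : hom Y Z) (f : hom X Y) : is_epi (g ∘ f) -> is_epi g.
Proof. by move=> gfe; apply: epi0 => T h hg; apply: (epiP gfe); rewrite compA hg comp0m. Qed.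

Lemma mono_split X Y (f : hom X Y) (g : hom Y X) : g ∘ f = idm X -> is_mono f.
Proof. by move=> gf; apply: mono0 => T h fh; rewrite -[h]comp1m -gf -compA fh compm0. Qed.

Lemma epi_split X Y (f : hom X Y) (g : hom Y X) : f ∘ g = idm Y -> is_epi f.
Proof. by move=> fg; apply: epi0 => T h hf; rewrite -[h]compm1 -fg compA hf comp0m. Qed.

Lemma kernel_lift X Y Z T (g : hom Y Z) (k : hom X Y) (t : hom T Y) :
  is_kernel g k -> g ∘ t = 0 -> exists h, k ∘ h = t.
Proof. by move=> [_ kP] /kP[h [kh _]]; exists h. Qed.

Lemma cokernel_desc X Y Z T (f : hom X Y) (q : hom Y Z) (t : hom Y T) :
  is_cokernel f q -> t ∘ f = 0 -> exists h, h ∘ q = t.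
Proof. by move=> [_ qP] /qP[h [hq _]]; exists h. Qed.

Lemma kernelI X Y Z (g : hom Y Z) (k : hom X Y) :
  g ∘ k = 0 -> is_mono k -> (forall T (t : hom T Y), g ∘ t = 0 -> exists h, k ∘ h = t) ->
  is_kernel g k.
Proof.
move=> gk km kP; split=> // T t /kP[h kh]; exists h; split=> // h' kh'.
by apply: km; rewrite kh kh'.
Qed.

Lemma cokernelI X Y Z (f : hom X Y) (q : hom Y Z) :
  q ∘ f = 0 -> is_epi q -> (forall T (t : hom Y T), t ∘ f = 0 -> exists h, h ∘ q = t) ->
  is_cokernel f q.
Proof.
move=> qf qe qP; split=> // T t /qP[h hq]; exists h; split=> // h' hq'.
by apply: qe; rewrite hq hq'.
Qed.

Lemma kernel_comp_mono X Y Z W (g : hom Y Z) (k : hom X Y) (m : hom Z W) :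
  is_mono m -> is_kernel g k -> is_kernel (m ∘ g) k.
Proof.
move=> mm [gk kP]; split=> [|T t]; first by rewrite -compA gk compm0.
by rewrite -compA => /(monoP mm)/kP.
Qed.

Lemma kernel_of_comp X Y Z W (g : hom Y Z) (k : hom X Y) (m : hom Z W) :
  is_mono m -> is_kernel (m ∘ g) k -> is_kernel g k.
Proof.
move=> mm [gk kP]; split=> [|T t gt]; first by apply: (monoP mm); rewrite compA.
by apply: kP; rewrite -compA gt compm0.
Qed.

Lemma cokernel_comp_epi X Y Z W (f : hom X Y) (q : hom Y Z) (e : hom W X) :
  is_epi e -> is_cokernel f q -> is_cokernel (f ∘ e) q.
Proof.
move=> ee [qf qP]; split=> [|T t]; first by rewrite compA qf comp0m.
by rewrite compA => /(epiP ee)/qP.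
Qed.

Lemma short_exact_comp0 X Y Z (i : hom X Y) (p : hom Y Z) : short_exact i p -> p ∘ i = 0.
Proof. by case=> [[]]. Qed.

Lemma short_exact_mono X Y Z (i : hom X Y) (p : hom Y Z) : short_exact i p -> is_mono i.
Proof. by case=> /kernel_mono. Qed.

Lemma short_exact_epi X Y Z (i : hom X Y) (p : hom Y Z) : short_exact i p -> is_epi p.
Proof. by case=> _ /cokernel_epi. Qed.

Lemma exact_comp0 X Y Z (f : hom X Y) (g : hom Y Z) : exact f g -> g ∘ f = 0.
Proof. by move=> [K [k [e [[gk _] _ ->]]]]; rewrite compA gk comp0m. Qed.

Lemma biproduct_hom_ext X Y Z (S : biproduct X Y) (f g : hom S Z) :
  f ∘ in1 S = g ∘ in1 S -> f ∘ in2 S = g ∘ in2 S -> f = g.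
Proof.
move=> e1 e2; rewrite -[f]compm1 -[g]compm1 -(in_pr S) !compDr !compA.
by rewrite e1 e2.
Qed.

Lemma biproduct_hom_ext' X Y Z (S : biproduct X Y) (f g : hom Z S) :
  pr1 S ∘ f = pr1 S ∘ g -> pr2 S ∘ f = pr2 S ∘ g -> f = g.
Proof.
move=> e1 e2; rewrite -[f]comp1m -[g]comp1m -(in_pr S) !compDl -!compA.
by rewrite e1 e2.
Qed.

Lemma pr1_in2K X Y T (S : biproduct X Y) (f : hom T Y) : pr1 S ∘ (in2 S ∘ f) = 0.
Proof. by rewrite compA pr1_in2 comp0m. Qed.

Lemma pr2_in1K X Y T (S : biproduct X Y) (f : hom T X) : pr2 S ∘ (in1 S ∘ f) = 0.
Proof. by rewrite compA pr2_in1 comp0m. Qed.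

Lemma pr1_in1K X Y T (S : biproduct X Y) (f : hom T X) : pr1 S ∘ (in1 S ∘ f) = f.
Proof. by rewrite compA pr1_in1 comp1m. Qed.

Lemma pr2_in2K X Y T (S : biproduct X Y) (f : hom T Y) : pr2 S ∘ (in2 S ∘ f) = f.
Proof. by rewrite compA pr2_in2 comp1m. Qed.

Definition row X Y Z (S : biproduct X Y) (f : hom X Z) (g : hom Y Z) : hom S Z :=
  f ∘ pr1 S + g ∘ pr2 S.

Lemma row_in1 X Y Z (S : biproduct X Y) (f : hom X Z) (g : hom Y Z) :
  row S f g ∘ in1 S = f.
Proof. by rewrite compDl -!compA pr1_in1 pr2_in1 compm1 compm0 addr0. Qed.

Lemma row_in2 X Y Z (S : biproduct X Y) (f : hom X Z) (g : hom Y Z) :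
  row S f g ∘ in2 S = g.
Proof. by rewrite compDl -!compA pr1_in2 pr2_in2 compm1 compm0 add0r. Qed.

Definition col X Y Z (S : biproduct X Y) (f : hom Z X) (g : hom Z Y) : hom Z S :=
  in1 S ∘ f + in2 S ∘ g.

Lemma pr1_col X Y Z (S : biproduct X Y) (f : hom Z X) (g : hom Z Y) :
  pr1 S ∘ col S f g = f.
Proof. by rewrite compDr pr1_in1K pr1_in2K addr0. Qed.

Lemma pr2_col X Y Z (S : biproduct X Y) (f : hom Z X) (g : hom Z Y) :
  pr2 S ∘ col S f g = g.
Proof. by rewrite compDr pr2_in1K pr2_in2K add0r. Qed.

Lemma row_col X Y Z W (S : biproduct X Y) (f : hom X Z) (g : hom Y Z)
  (f' : hom W X) (g' : hom W Y) : row S f g ∘ col S f' g' = f ∘ f' + g ∘ g'.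
Proof. by rewrite compDl -!compA pr1_col pr2_col. Qed.

Lemma row_comp X Y Z W (S : biproduct X Y) (f : hom X Z) (g : hom Y Z) (h : hom Z W) :
  h ∘ row S f g = row S (h ∘ f) (h ∘ g).
Proof. by rewrite compDr !compA. Qed.

Lemma row_eta X Y Z (S : biproduct X Y) (f : hom S Z) : f = row S (f ∘ in1 S) (f ∘ in2 S).
Proof. by apply: (@biproduct_hom_ext _ _ _ S); rewrite ?row_in1 ?row_in2. Qed.

Lemma pushout_hom_ext X Y Y' Z T (a : hom X Y) (b : hom X Y') (c : hom Y Z) (d : hom Y' Z)
    (f g : hom Z T) :
  is_pushout a b c d -> f ∘ c = g ∘ c -> f ∘ d = g ∘ d -> f = g.
Proof.
move=> [cd cdP] fc fd; have [|h [_ hP]] := cdP _ (g ∘ c) (g ∘ d).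
  by rewrite -!compA cd.
by rewrite -(hP f) // -(hP g).
Qed.

Lemma pushout_desc X Y Y' Z T (a : hom X Y) (b : hom X Y') (c : hom Y Z) (d : hom Y' Z)
    (s : hom Y T) (t : hom Y' T) :
  is_pushout a b c d -> s ∘ a = t ∘ b -> exists h, h ∘ c = s /\ h ∘ d = t.
Proof. by move=> [_ P] /P[h [? _]]; exists h. Qed.

(** Right exact functors are given by their effect on cokernels; this form lets them act on pushouts
    as well. *)
Lemma pushoutP X Y Y' Z (S : biproduct Y Y') (a : hom X Y) (b : hom X Y')
    (c : hom Y Z) (d : hom Y' Z) :
  is_pushout a b c d <-> is_cokernel (col S a (- b)) (row S c d).
Proof.
have rc T (s : hom Y T) (t : hom Y' T) :
    s ∘ a = t ∘ b <-> row S s t ∘ col S a (- b) = 0.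
  by rewrite row_col compmN; split=> [->|/eqP]; rewrite ?subrr // subr_eq0 => /eqP.
split=> [[/rc cd cdP]|[/rc cd cdP]]; split=> // T.
  move=> t; rewrite [t](row_eta (S := S)) => /rc/cdP[h [[hc hd] hP]].
  exists h; split; first by rewrite row_comp hc hd.
  by move=> h' e; apply: hP; rewrite -(row_in1 S c d) -{2}(row_in2 S c d) !compA e row_in1 row_in2.
move=> s t /rc/cdP[h [hst hP]]; exists h; split.
  by rewrite -(row_in1 S c d) -{2}(row_in2 S c d) !compA hst row_in1 row_in2.
by move=> h' [hc hd]; apply: hP; rewrite row_comp hc hd.
Qed.

End Preadditive.

(** * Opposite categories and duality *)

Section Opposite.

(** Composition is reversed definitionally, so a lemma applied in [op A] yields its dual in [A] by
    conversion. *)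
Definition op (A : preadditive) : preadditive.
Proof.
exists A (fun X Y => @hom A Y X) idm (fun X Y Z g f => f ∘ g) => *.
- by rewrite compA.
- by rewrite compm1.
- by rewrite comp1m.
- by rewrite compDr.
- by rewrite compDl.
Defined.

Definition op_biproduct (A : preadditive) (X Y : A) (S : biproduct X Y) :
  @biproduct (op A) X Y.
Proof.
refine (@Biproduct (op A) X Y (bp S) (pr1 S) (pr2 S) (in1 S) (in2 S) _ _ _ _ _).
- exact: (pr1_in1 S).
- exact: (pr2_in2 S).
- exact: (pr2_in1 S).
- exact: (pr1_in2 S).
- exact: (in_pr S).
Defined.

Definition opab (A : abelian) : abelian.
Proof.
exists (op A).
- by have [Z ZP] := has_zero A; exists Z => Y; have [? ?] := ZP Y; split.
- by move=> X Y; exact: op_biproduct (biprod X Y).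
- by move=> X Y f; have [Q [q qP]] := has_cokernels (a := A) f; exists Q, q.
- by move=> X Y f; have [Q [q qP]] := has_kernels (a := A) f; exists Q, q.
- by move=> X Y f fm; have [Z [g gP]] := epi_normal (a := A) fm; exists Z, g.
- by move=> X Y f fm; have [Z [g gP]] := mono_normal (a := A) fm; exists Z, g.
Defined.

End Opposite.

Definition is_pullback (A : preadditive) (X Y Y' Z : A) (a : hom Y X) (b : hom Y' X)
  (c : hom Z Y) (d : hom Z Y') := @is_pushout (op A) X Y Y' Z a b c d.

Section Abelian.
Variable A : abelian.
Implicit Types X Y Z : A.

Lemma short_exact_mono_coker X Y Z (i : hom X Y) (p : hom Y Z) :
  is_mono i -> is_cokernel i p -> short_exact i p.
Proof. by move=> im ip; split=> //; exact: mono_ker_coker. Qed.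

Lemma short_exact_epi_ker X Y Z (i : hom X Y) (p : hom Y Z) :
  is_epi p -> is_kernel p i -> short_exact i p.
Proof. by move=> im ip; split=> //; exact: epi_coker_ker. Qed.

Lemma epi_short_exact Y Z (p : hom Y Z) : is_epi p -> exists X (i : hom X Y), short_exact i p.
Proof.
by move=> pe; have [Z' [i ip]] := has_kernels p; exists Z', i; exact: short_exact_epi_ker.
Qed.

Lemma mono_epi_iso X Y (f : hom X Y) : is_mono f -> is_epi f -> is_iso f.
Proof.
move=> fm fe; have [Z [g [gf fP]]] := mono_normal fm.
have g0 : g = 0 by exact: epiP gf.
have [h [fh _]] := fP Y (idm Y) ltac:(by rewrite g0 comp0m).
exists h; split=> //; apply: fm.
by rewrite compA fh comp1m compm1.
Qed.

Lemma pushout_exists X Y Y' (a : hom X Y) (b : hom X Y') :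
  exists Z (c : hom Y Z) (d : hom Y' Z), is_pushout a b c d.
Proof.
pose S := biprod Y Y'; have [Z [q qP]] := has_cokernels (col S a (- b)).
exists Z, (q ∘ in1 S), (q ∘ in2 S); apply/(pushoutP S).
by rewrite -row_eta.
Qed.

(** The map with components [a] and [- b] is mono, hence the kernel of the map onto the pushout. An
    element of the form [(0, t)] in it is [(a h, - b h)] with [a h = 0], so it vanishes. *)
Lemma pushout_mono X Y Y' Z (a : hom X Y) (b : hom X Y') (c : hom Y Z) (d : hom Y' Z) :
  is_pushout a b c d -> is_mono a -> is_mono d.
Proof.
move=> /(pushoutP (biprod Y Y')); set S := biprod _ _ => P am.
have m : is_mono (col S a (- b)).
  by apply: (@mono_of_comp _ _ _ _ (pr1 S)); rewrite pr1_col.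
apply: mono0 => T t dt.
have [|h e] := kernel_lift (t := in2 S ∘ t) (mono_ker_coker m P).
  by rewrite compA row_in2.
have h0 : h = 0.
  by apply: (monoP am); have := congr1 (comp (pr1 S)) e; rewrite compA pr1_col pr1_in2K.
by rewrite -(pr2_in2K S t) -e h0 !compm0.
Qed.

Lemma pushout_cokernel X Y Y' Z W (a : hom X Y) (b : hom X Y') (c : hom Y Z) (d : hom Y' Z)
    (p : hom Y W) :
  is_pushout a b c d -> is_cokernel a p ->
  exists p' : hom Z W, [/\ p' ∘ c = p, p' ∘ d = 0 & is_cokernel d p'].
Proof.
move=> P ap; have [|p' [p'c p'd]] := pushout_desc (s := p) (t := 0) P.
  by rewrite comp0m (proj1 ap).
exists p'; split=> //; apply: cokernelI => //.
  by apply: (@epi_of_comp _ _ _ _ p' c); rewrite p'c; exact: cokernel_epi ap.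
move=> T t td; have [|h hp] := cokernel_desc (t := t ∘ c) ap.
  by rewrite -compA (proj1 P) compA td comp0m.
exists h; apply: (pushout_hom_ext P); rewrite -compA; first by rewrite p'c.
by rewrite p'd compm0.
Qed.

Lemma pushout_short_exact X Y Y' Z W (a : hom X Y) (b : hom X Y') (c : hom Y Z)
    (d : hom Y' Z) (p : hom Y W) :
  is_pushout a b c d -> short_exact a p ->
  exists p' : hom Z W, p' ∘ c = p /\ short_exact d p'.
Proof.
move=> P ap; have [p' [p'c _ dp']] := pushout_cokernel P (proj2 ap).
exists p'; split=> //; apply: short_exact_mono_coker => //.
exact: pushout_mono P (short_exact_mono ap).
Qed.

End Abelian.

Lemma short_exact_op (A : preadditive) (X Y Z : A) (i : hom X Y) (p : hom Y Z) :
  short_exact i p <-> @short_exact (op A) Z Y X p i.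
Proof. by split=> -[? ?]; split. Qed.

(** * Diagram chases with generalized elements *)

Section AbelianChase.
Variable A : abelian.
Implicit Types X Y Z : A.

Lemma pullback_exists X Y Y' (a : hom Y X) (b : hom Y' X) :
  exists Z (c : hom Z Y) (d : hom Z Y'), is_pullback a b c d.
Proof. exact: (@pushout_exists (opab A) X Y Y' a b). Qed.

Lemma pullback_short_exact X Y Y' Z W (a : hom Y X) (b : hom Y' X) (c : hom Z Y)
    (d : hom Z Y') (k : hom W Y) :
  is_pullback a b c d -> short_exact k a ->
  exists k' : hom W Z, c ∘ k' = k /\ short_exact k' d.
Proof.
move=> P /short_exact_op ka.
have [k' [? /short_exact_op]] := @pushout_short_exact (opab A) _ _ _ _ _ _ _ _ _ _ P ka.
by exists k'.
Qed.

(** This replaces the choice of a preimage in a diagram chase; it holds because epimorphisms are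
    stable under pullback. *)
Lemma epi_cover X Y T (p : hom X Y) (y : hom T Y) :
  is_epi p -> exists T' (c : hom T' T) (x : hom T' X), is_epi c /\ p ∘ x = y ∘ c.
Proof.
move=> pe; have [W [x [c P]]] := pullback_exists p y.
by exists W, c, x; split; [exact: (@pushout_mono (opab A) _ _ _ _ _ _ _ _ P pe)|exact: (proj1 P)].
Qed.

Lemma cokernel_exact X Y Z (a : hom X Y) (b : hom Y Z) : is_cokernel a b -> exact a b.
Proof.
move=> ab; have [K [k bk]] := has_kernels b; have km := kernel_mono bk.
have [e ke] := kernel_lift bk (proj1 ab); exists K, k, e; split=> //.
apply: epi0 => T t te; have [N [m tm]] := has_kernels t.
have [e' me] := kernel_lift tm te; have mm := kernel_mono tm.
(* The subobject [N] of [K] still contains the image of [a]. As the kernel of some [g] that kills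
   [a], and hence factors through [b], it contains the kernel [K] of [b]; so [m] is split epi and
   [t = 0]. *)
have [W [g gkm]] := mono_normal (mono_comp km mm).
have [|g' gb] := cokernel_desc (t := g) ab.
  by rewrite -ke -me [k ∘ _]compA compA (proj1 gkm) comp0m.
have [|n kmn] := kernel_lift (t := k) gkm; first by rewrite -gb -compA (proj1 bk) compm0.
have mn : m ∘ n = idm K by apply: km; rewrite compA kmn compm1.
by rewrite -[t]compm1 -mn compA (proj1 tm) comp0m.
Qed.

(* Exactness tested on generalized elements, up to an epimorphism. *)
Lemma exact_cover X Y Z T (a : hom X Y) (b : hom Y Z) (y : hom T Y) :
  exact a b -> b ∘ y = 0 ->
  exists T' (c : hom T' T) (x : hom T' X), is_epi c /\ a ∘ x = y ∘ c.
Proof.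
move=> [K [k [e [bk ee ->]]]] /(kernel_lift bk)[z <-].
have [T' [c [x [ce ex]]]] := epi_cover z ee.
by exists T', c, x; split=> //; rewrite -!compA ex.
Qed.

Lemma exact_cokernel X Y Z (a : hom X Y) (b : hom Y Z) : exact a b -> is_epi b -> is_cokernel a b.
Proof.
move=> [K [k [e [bk ee ->]]]] be; apply: cokernel_comp_epi => //.
exact: epi_coker_ker.
Qed.

Section ShortFive.
Variables (X Y Y' Z : A) (i : hom X Y) (p : hom Y Z) (i' : hom X Y') (p' : hom Y' Z).
Variable g : hom Y Y'.
Hypotheses (ip : short_exact i p) (ip' : short_exact i' p').
Hypotheses (gi : g ∘ i = i') (pg : p' ∘ g = p).

Lemma short_five_mono : is_mono g.
Proof.
apply: mono0 => T t gt; have [|s st] := kernel_lift (t := t) (proj1 ip).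
  by rewrite -pg -compA gt compm0.
have s0 : s = 0.
  by apply: (monoP (short_exact_mono ip')); rewrite -gi -compA st.
by rewrite -st s0 compm0.
Qed.

Lemma short_five_epi : is_epi g.
Proof.
apply: epi0 => T t tg; have [|s st] := cokernel_desc (t := t) (proj2 ip').
  by rewrite -gi compA tg comp0m.
have s0 : s = 0.
  by apply: (epiP (short_exact_epi ip)); rewrite -pg compA st.
by rewrite -st s0 comp0m.
Qed.

Lemma short_five : is_iso g.
Proof. exact: mono_epi_iso short_five_mono short_five_epi. Qed.

End ShortFive.

(** The comparison from the true pushout is a map of extensions with identities at both ends, so the
    short five lemma applies. *)
Lemma short_exact_pushout X Y Y' Z W (a : hom X Y) (b : hom X Y') (c : hom Y Z)
    (d : hom Y' Z) (p : hom Y W) (p' : hom Z W) :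
  short_exact a p -> short_exact d p' -> c ∘ a = d ∘ b -> p' ∘ c = p ->
  is_pushout a b c d.
Proof.
move=> ap dp' cadb p'c; have [Z0 [c0 [d0 P]]] := pushout_exists a b.
have [p0 [p0c0 dp0]] := pushout_short_exact P ap.
have [g [gc gd]] := pushout_desc P cadb.
have [|g' [g'g gg']] := @short_five _ _ _ _ _ _ _ _ g dp0 dp' gd.
  apply: (pushout_hom_ext P); rewrite -compA ?gc ?gd ?p'c ?p0c0 //.
  by rewrite !short_exact_comp0.
split=> // T s t /(pushout_desc P)[h [hc hd]]; exists (h ∘ g'); split.
  by split; rewrite -?gc -?gd compA (comp_1 _ g'g).
move=> h' [h'c h'd]; rewrite -[h']compm1 -gg' compA; congr (_ ∘ _).
by apply: (pushout_hom_ext P); rewrite -compA ?gc ?gd ?hc ?hd.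
Qed.

Lemma biproduct_short_exact X Y (S : biproduct X Y) : short_exact (in1 S) (pr2 S).
Proof.
apply: short_exact_mono_coker; first exact: mono_split (pr1_in1 S).
apply: cokernelI.
- exact: pr2_in1.
- exact: epi_split (pr2_in2 S).
- move=> T t t1; exists (t ∘ in2 S); apply: (@biproduct_hom_ext _ _ _ _ S).
    by rewrite t1 -compA pr2_in1 compm0.
  by rewrite -compA pr2_in2 compm1.
Qed.

End AbelianChase.

(** * Vanishing of Ext *)

Section Splitting.
Variable A : abelian.
Implicit Types X Y Z : A.

(** With [lift1], one of two forms of Ext^1(X, Y) = 0 that avoid resolutions; duality exchanges
    them. The lifting form passes through the adjunction of [T] and [U]; the extension form is the
    one needed for hulls. *)
Definition ext1 X Y := forall K E (k : hom K E) (p : hom E X), short_exact k p ->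
  forall f : hom K Y, exists g : hom E Y, g ∘ k = f.

Definition lift1 X Y := forall E Z (i : hom Y E) (p : hom E Z), short_exact i p ->
  forall f : hom X Z, exists g : hom X E, p ∘ g = f.

Lemma short_exact_section X Y Z (i : hom X Y) (p : hom Y Z) (r : hom Y X) :
  short_exact i p -> r ∘ i = idm X -> exists s : hom Z Y, p ∘ s = idm Z.
Proof.
move=> ip ri; have [|s sp] := cokernel_desc (t := idm Y - i ∘ r) (proj2 ip).
  by rewrite compDl compNm comp1m -compA ri compm1 subrr.
exists s; apply: (short_exact_epi ip).
by rewrite -compA sp compDr compmN compA (short_exact_comp0 ip) comp0m subr0 comp1m compm1.
Qed.

(** The pullback of the sequence along [f] has kernel [Y]; extending [idm Y] splits it, and a
    section gives the lift. *)
Lemma ext1_lift1 X Y : ext1 X Y -> lift1 X Y.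
Proof.
move=> XY E Z i p ip f; have [W [p' [f' P]]] := pullback_exists p f.
have [i' [p'i ip']] := pullback_short_exact P ip.
have [r ri] := XY _ _ _ _ ip' (idm Y).
have [s fs] := short_exact_section ip' ri; exists (p' ∘ s).
rewrite compA; have /= -> : p ∘ p' = f ∘ f' by exact: (proj1 P).
by rewrite -compA fs compm1.
Qed.

End Splitting.

Section SplittingOp.
Variable A : abelian.
Implicit Types X Y Z : A.

Lemma ext1E X Y : ext1 X Y <-> @lift1 (opab A) Y X.
Proof.
by split=> H K E k p /short_exact_op kp f; have [g] := H _ _ p k kp f; exists g.
Qed.

Lemma lift1E X Y : lift1 X Y <-> @ext1 (opab A) Y X.
Proof.
by split=> H K E k p /short_exact_op kp f; have [g] := H _ _ p k kp f; exists g.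
Qed.

Lemma lift1_ext1 X Y : lift1 X Y -> ext1 X Y.
Proof. by move=> /lift1E/ext1_lift1/ext1E. Qed.

Lemma ext1_retractl X X' Y (u : hom X X') (v : hom X' X) :
  v ∘ u = idm X -> ext1 X' Y -> ext1 X Y.
Proof.
move=> vu /ext1_lift1 XY; apply: lift1_ext1 => E Z i p ip f.
by have [g pg] := XY _ _ _ _ ip (f ∘ v); exists (g ∘ u); rewrite compA pg -compA vu compm1.
Qed.

Lemma ext1_retractr X Y Y' (u : hom Y Y') (v : hom Y' Y) :
  v ∘ u = idm Y -> ext1 X Y' -> ext1 X Y.
Proof.
move=> vu XY K E k p kp f.
by have [g gk] := XY _ _ _ _ kp (u ∘ f); exists (v ∘ g); rewrite -compA gk compA vu comp1m.
Qed.

(** With [E1] the kernel of [E] → [X2], a map on [K] extends to [E1] because [E1 / K] is [X1], and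
    from there to [E] because [E / E1] is [X2]. *)
Lemma ext1_extensionl X1 X X2 Y (i : hom X1 X) (q : hom X X2) :
  short_exact i q -> ext1 X1 Y -> ext1 X2 Y -> ext1 X Y.
Proof.
move=> iq XY1 XY2 K E k p kp f.
have [E1 [j jqp]] := epi_short_exact (epi_comp (short_exact_epi iq) (short_exact_epi kp)).
have [|k' jk] := kernel_lift (t := k) (proj1 jqp).
  by rewrite -compA (short_exact_comp0 kp) compm0.
have [|p' ip'] := kernel_lift (t := p ∘ j) (proj1 iq).
  by rewrite compA; exact: short_exact_comp0 jqp.
have kp' : short_exact k' p'.
  apply: short_exact_epi_ker.
    apply: epi0 => T t tp'.
    have [T' [c [y [ce py]]]] := epi_cover i (short_exact_epi kp).
    have [|y' jy] := kernel_lift (t := y) (proj1 jqp).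
      by rewrite -compA py compA (short_exact_comp0 iq) comp0m.
    have yc : p' ∘ y' = c.
      by apply: (short_exact_mono iq); rewrite compA ip' -compA jy.
    by apply: (epiP ce); rewrite -yc compA tp' comp0m.
  apply: (@kernel_of_comp _ _ _ _ _ _ _ i); first exact: short_exact_mono iq.
  rewrite ip'; apply: kernelI.
  - by rewrite -compA jk (short_exact_comp0 kp).
  - by apply: (@mono_of_comp _ _ _ _ j); rewrite jk; exact: short_exact_mono kp.
  - move=> T t; rewrite -compA => /(kernel_lift (proj1 kp))[h kh]; exists h.
    by apply: (short_exact_mono jqp); rewrite compA jk.
have [g1 g1k] := XY1 _ _ _ _ kp' f.
have [g gj] := XY2 _ _ _ _ jqp g1.
by exists g; rewrite -jk compA gj.
Qed.

End SplittingOp.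

Lemma ext1_extensionr (A : abelian) (X Y1 Y Y2 : A) (i : hom Y1 Y) (q : hom Y Y2) :
  short_exact i q -> ext1 X Y1 -> ext1 X Y2 -> ext1 X Y.
Proof.
move=> /short_exact_op iq /ext1_lift1/lift1E XY1 /ext1_lift1/lift1E XY2.
apply: lift1_ext1; apply/lift1E.
exact: (@ext1_extensionl (opab A) _ _ _ _ _ _ iq).
Qed.

(** * Resolutions, syzygies and dimension shifting *)

Section Ext.
Variable A : abelian.
Hypothesis epA : enough_projectives A.
Implicit Types X Y Z : A.

Lemma proj_cover X : exists (P K : A) (k : hom K P) (p : hom P X),
  projective P /\ short_exact k p.
Proof.
have [P [p [Pproj pe]]] := epA X; have [K [k kp]] := epi_short_exact pe.
by exists P, K, k, p.
Qed.

Lemma proj_resolution_exists X : exists R : proj_resolution X, True.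
Proof.
(* A cover and its syzygy are chosen for all objects at once; iterating the syzygy function then
   gives the resolution. *)
have pick Y : {t : {P : A & {K : A & (hom K P * hom P Y)%type}} |
    projective (tag t) /\ short_exact (tagged (tagged t)).1 (tagged (tagged t)).2}.
  apply: cid; have [P [K [k [p kp]]]] := proj_cover Y.
  by exists (Tagged (fun P => {K : A & (hom K P * hom P Y)%type})
               (Tagged (fun K => hom K P * hom P Y)%type (k, p))).
pose P Y := tag (sval (pick Y)); pose K Y := tag (tagged (sval (pick Y))).
pose k Y : hom (K Y) (P Y) := (tagged (tagged (sval (pick Y)))).1.
pose p Y : hom (P Y) Y := (tagged (tagged (sval (pick Y)))).2.
have Pproj Y : projective (P Y) by exact: (proj1 (svalP (pick Y))).
have kp Y : short_exact (k Y) (p Y) by exact: (proj2 (svalP (pick Y))).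
unshelve eexists; last by [].
exists (fun n => P (iter n K X)) (fun n => k (iter n K X) ∘ p (iter n.+1 K X)) (p X) => //.
- exact: short_exact_epi (kp X).
- exists (K X), (k X), (p (K X)); split=> //; first exact: (proj1 (kp _)).
  exact: short_exact_epi (kp _).
- move=> n; set Y := iter n K X.
  exists (K (K Y)), (k (K Y)), (p (K (K Y))); split=> //; last exact: short_exact_epi (kp _).
  by apply: kernel_comp_mono; [exact: short_exact_mono (kp _)|exact: (proj1 (kp _))].
Qed.

Section Syzygy.
Variables (X : A) (R : proj_resolution X).

Lemma resolution_syzygy : exists K (k : hom K (R 0%N)) (e : hom (R 1%N) K),
  [/\ short_exact k (aug R), is_cokernel (dif R 1) e & dif R 0 = k ∘ e].
Proof.
have [K [k [e [Rk ee dE]]]] := aug_exact R; exists K, k, e; split=> //.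
  exact: short_exact_epi_ker (@aug_epi _ _ R) Rk.
apply: exact_cokernel => //; have [L [l [e' [dl e'e d1E]]]] := dif_exact R 0.
exists L, l, e'; split=> //; move: dl; rewrite dE.
by apply: kernel_of_comp; exact: kernel_mono Rk.
Qed.

End Syzygy.

(** Every extension of [X] is a pushout of the given projective presentation, so extending maps from
    [K] to [P] is enough. *)
Lemma ext1_of_cover X Y P K (k : hom K P) (p : hom P X) :
  projective P -> short_exact k p ->
  (forall f : hom K Y, exists g, g ∘ k = f) -> ext1 X Y.
Proof.
move=> Pproj kp KY K0 E k0 p0 kp0 f0.
have [u pu] := Pproj _ _ p0 p (short_exact_epi kp0).
have [|u' ku] := kernel_lift (t := u ∘ k) (proj1 kp0).
  by rewrite compA pu (short_exact_comp0 kp).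
have po := short_exact_pushout kp kp0 (esym ku) pu.
have [g gk] := KY (f0 ∘ u').
have [h [hu hk]] := pushout_desc po gk.
by exists h.
Qed.

Lemma ext1P X Y : ExtS_zero 0 X Y <-> ext1 X Y.
Proof.
split=> [XY|XY R f fd].
  have [R _] := proj_resolution_exists X; have [K [k [e [kp de dE]]]] := resolution_syzygy R.
  apply: (ext1_of_cover (@res_proj _ _ R 0) kp) => f.
  have [|g gd] := XY R (f ∘ e); first by rewrite -compA (proj1 de) compm0.
  exists g; apply: (cokernel_epi de).
  by rewrite -compA -dE.
have [K [k [e [kp de dE]]]] := resolution_syzygy R.
have [f' fe] := cokernel_desc de fd.
have [g gk] := XY _ _ _ _ kp f'; exists g.
by rewrite dE compA gk.
Qed.

(** A resolution of a syzygy is prolonged by [P] to one of [X]; conversely, a resolution of [X] is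
    truncated to one of its first syzygy. *)
Lemma ExtS_shift n X Y : ExtS_zero n.+1 X Y <->
  forall P K (k : hom K P) (p : hom P X), projective P -> short_exact k p -> ExtS_zero n K Y.
Proof.
split=> [XY P K k p Pproj kp R f fd|XY R f fd].
  pose res' i := if i is j.+1 then R j else P.
  pose dif' i : hom (res' i.+1) (res' i) :=
    if i is j.+1 return hom (res' i.+1) (res' i) then dif R j else k ∘ aug R.
  have [L [l [e [lp de dE]]]] := resolution_syzygy R.
  have proj i : projective (res' i) by case: i => [|i] //=; exact: res_proj.
  have aug_ex : exact (dif' 0%N) p.
    by exists K, k, (aug R); split=> //; [exact: (proj1 kp)|exact: aug_epi].
  have dif_ex i : exact (dif' i.+1) (dif' i).
    case: i => [|i] /=; last exact: dif_exact.
    exists L, l, e; split=> //; last exact: cokernel_epi de.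
    apply: kernel_comp_mono (proj1 lp); exact: short_exact_mono kp.
  exact: (XY (ProjResolution proj (short_exact_epi kp) aug_ex dif_ex) f fd).
have [K [k [e [kp de dE]]]] := resolution_syzygy R.
pose R' := @ProjResolution A K (fun i => R i.+1) (fun i => dif R i.+1) e
  (fun i => @res_proj _ _ R i.+1) (cokernel_epi de) (cokernel_exact de)
  (fun i => dif_exact R i.+1).
exact: (XY _ _ _ _ (@res_proj _ _ R 0) kp R' f fd).
Qed.

(** The equation on [idm X] says that [X] is a retract of [X'] plus a projective. Independence of
    the chosen cover is a special case, since two syzygies of one object are related in this way
    (Schanuel). *)
Lemma ExtS_stable n X X' Y Q (u : hom X X') (v : hom X' X) (a : hom X Q) (b : hom Q X) :
  projective Q -> idm X = v ∘ u + b ∘ a -> ExtS_zero n X' Y -> ExtS_zero n X Y.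
Proof.
elim: n X X' Q u v a b => [|n IH] X X' Q u v a b Qproj e XY.
  move/ext1P/ext1_lift1: XY => XY; apply/ext1P/lift1_ext1 => E Z i p ip f.
  have [g pg] := XY _ _ _ _ ip (f ∘ v).
  have [h ph] := Qproj _ _ p (f ∘ b) (short_exact_epi ip).
  by exists (g ∘ u + h ∘ a); rewrite compDr !compA pg ph -!compA -compDr -e compm1.
apply/ExtS_shift => P K k p Pproj kp.
have [P' [K' [k' [p' [Pproj' kp']]]]] := proj_cover X'.
have {}XY : ExtS_zero n K' Y by move/ExtS_shift: XY => /(_ _ _ _ _ Pproj' kp').
have [u1 pu1] := Pproj _ _ p' (u ∘ p) (short_exact_epi kp').
have [v1 pv1] := Pproj' _ _ p (v ∘ p') (short_exact_epi kp).
have [b1 pb1] := Qproj _ _ p b (short_exact_epi kp).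
have [|u2 ku2] := kernel_lift (t := u1 ∘ k) (proj1 kp').
  by rewrite compA pu1 -compA (short_exact_comp0 kp) compm0.
have [|v2 kv2] := kernel_lift (t := v1 ∘ k') (proj1 kp).
  by rewrite compA pv1 -compA (short_exact_comp0 kp') compm0.
(* [p] kills this map because [v ∘ u + b ∘ a] is the identity. On [K] the term with [b1] vanishes,
   which leaves [idm K = v2 ∘ u2 + h ∘ k]: the same relation one syzygy down, with [P] in the role
   of [Q]. *)
have [|h kh] := kernel_lift (t := idm P - v1 ∘ u1 - b1 ∘ a ∘ p) (proj1 kp).
  rewrite !compDr !compmN compm1 !compA pv1 pb1 (comp_eq _ pu1) compA.
  by rewrite -addrA -opprD -compDl -e comp1m subrr.
apply: (IH K K' P u2 v2 k h) => //; apply: (short_exact_mono kp).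
rewrite compDr !compA kh kv2 !compDl !compNm comp1m compm1 (comp_eq _ ku2) compA.
rewrite (comp_0 _ (short_exact_comp0 kp)) subr0.
by rewrite addrC subrK.
Qed.

Lemma ExtS_cover n X Y P K (k : hom K P) (p : hom P X) :
  projective P -> short_exact k p -> ExtS_zero n K Y -> ExtS_zero n.+1 X Y.
Proof.
move=> Pproj kp KY; apply/ExtS_shift => P' K' k' p' Pproj' kp'.
have [u pu] := Pproj' _ _ p p' (short_exact_epi kp).
have [v pv] := Pproj _ _ p' p (short_exact_epi kp').
have [|u' ku] := kernel_lift (t := u ∘ k') (proj1 kp).
  by rewrite compA pu (short_exact_comp0 kp').
have [|v' kv] := kernel_lift (t := v ∘ k) (proj1 kp').
  by rewrite compA pv (short_exact_comp0 kp).
have [|h kh] := kernel_lift (t := idm P' - v ∘ u) (proj1 kp').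
  by rewrite compDr compmN compm1 compA pv pu subrr.
apply: (@ExtS_stable n K' K Y P' u' v' k' h) => //; apply: (short_exact_mono kp').
rewrite compDr !compA kh kv compDl compNm comp1m compm1 (comp_eq _ ku) compA.
by rewrite addrC subrK.
Qed.

End Ext.

(** * Exactness from vanishing of the first left derived functor *)

Section LeftDerived.
Variables (A B : abelian) (F : add_functor A B).
Hypotheses (epA : enough_projectives A) (rexF : right_exact F).

Lemma fmap_zero (X Y : A) : fmap F (0 : hom X Y) = 0.
Proof. by apply: (addrI (fmap F 0)); rewrite -fmapD !addr0. Qed.

Lemma fmap_opp (X Y : A) (f : hom X Y) : fmap F (- f) = - fmap F f.
Proof. by apply/eqP; rewrite -addr_eq0 -fmapD addNr fmap_zero. Qed.

Definition fmap_biproduct (X Y : A) (S : biproduct X Y) : @biproduct B (F X) (F Y).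
Proof.
exists (F S) (fmap F (in1 S)) (fmap F (in2 S)) (fmap F (pr1 S)) (fmap F (pr2 S));
  rewrite -!fmap_comp.
- by rewrite pr1_in1 fmap1.
- by rewrite pr2_in2 fmap1.
- by rewrite pr1_in2 fmap_zero.
- by rewrite pr2_in1 fmap_zero.
- by rewrite -fmapD in_pr fmap1.
Defined.

Lemma right_exact_pushout (X Y Y' Z : A) (a : hom X Y) (b : hom X Y') (c : hom Y Z)
    (d : hom Y' Z) :
  is_pushout a b c d -> is_pushout (fmap F a) (fmap F b) (fmap F c) (fmap F d).
Proof.
pose S := biprod Y Y'; move=> /(pushoutP S)po; have P := rexF po.
apply/(pushoutP (fmap_biproduct S)); move: P.
by rewrite /row /col !fmapD !fmap_comp fmap_opp.
Qed.

(** For the syzygy [k] of a resolution of [Z] this is a direct computation. Any other sequence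
    ending in [Z] is a pushout of that one; [F] preserves the pushout, and pushouts preserve
    monomorphisms. *)
Lemma L1_zero_mono (X Y Z : A) (i : hom X Y) (p : hom Y Z) :
  L1_zero F Z -> short_exact i p -> is_mono (fmap F i).
Proof.
move=> L1Z ip; have [R _] := proj_resolution_exists epA Z.
have [K [k [e [kp de dE]]]] := resolution_syzygy R.
have Fk : is_mono (fmap F k).
  apply: mono0 => T t Ft; have Fde := rexF de.
  have [T' [c [y [ce ey]]]] := epi_cover t (cokernel_epi Fde).
  have [N [n dn]] := has_kernels (fmap F (dif R 0)).
  have [|m nm] := kernel_lift (t := fmap F (dif R 1)) dn.
    by rewrite -fmap_comp (exact_comp0 (dif_exact R 0)) fmap_zero.
  have [H [q mq]] := has_cokernels m.
  (* The cokernel of [m] is a value of the derived functor at [Z], hence zero. So every cycle in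
     [F (R 1)] is covered by boundaries, and [fmap F e] kills boundaries. *)
  have me : is_epi m.
    apply: epi0 => W w wm; have [w' <-] := cokernel_desc mq wm.
    have [|H0 _] := L1Z H _ W; last by rewrite (H0 w') comp0m.
    by exists R, N, n, m, q; split.
  have [|y' ny] := kernel_lift (t := y) dn.
    by rewrite dE fmap_comp -compA ey compA Ft comp0m.
  apply: (epiP ce); rewrite -ey -ny compA.
  suff -> : fmap F e ∘ n = 0 by rewrite comp0m.
  by apply: (epiP me); rewrite -compA nm; exact: (proj1 Fde).
have [u pu] := @res_proj _ _ R 0%N _ _ p (aug R) (short_exact_epi ip).
have [|u' ku] := kernel_lift (t := u ∘ k) (proj1 ip).
  by rewrite compA pu (short_exact_comp0 kp).
have po := short_exact_pushout kp ip (esym ku) pu.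
exact: pushout_mono (right_exact_pushout po) Fk.
Qed.

End LeftDerived.

(** * Trivial extensions *)

Section Adjoint.
Variables A A' : abelian.

(** The right adjoint is given objectwise by couniversal arrows, so it need not be assembled into a
    functor. *)
Definition left_adjoint (Φ : add_functor A A') := forall Y : A',
  exists (R : A) (ε : hom (Φ R) Y), forall (X : A) (f : hom (Φ X) Y),
    exists! g : hom X R, ε ∘ fmap Φ g = f.

Variable Φ : add_functor A A'.
Hypothesis adjΦ : left_adjoint Φ.

Lemma left_adjoint_pushout (X Y Y' Z : A) (a : hom X Y) (b : hom X Y')
    (c : hom Y Z) (d : hom Y' Z) :
  is_pushout a b c d -> is_pushout (fmap Φ a) (fmap Φ b) (fmap Φ c) (fmap Φ d).
Proof.
move=> po; split=> [|T s t]; first by rewrite -!fmap_comp (proj1 po).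
have [R [ε εP]] := adjΦ T.
have ε_inj W (g g' : hom W R) : ε ∘ fmap Φ g = ε ∘ fmap Φ g' -> g = g'.
  by move=> e; have [h [_ hP]] := εP _ (ε ∘ fmap Φ g'); rewrite -(hP g) // -(hP g').
have [s0 [<- _]] := εP _ s; have [t0 [<- _]] := εP _ t.
rewrite -!compA -!fmap_comp => /ε_inj/(pushout_desc po)[h [hc hd]].
exists (ε ∘ fmap Φ h); split; first by rewrite -!compA -!fmap_comp hc hd.
move=> h'; have [h0 [<- _]] := εP _ h'; rewrite -!compA -!fmap_comp => -[].
move=> /ε_inj h0c /ε_inj h0d; congr (_ ∘ fmap Φ _).
by apply: (pushout_hom_ext po); rewrite ?h0c ?h0d.
Qed.

Lemma left_adjoint_cokernel (X Y Z : A) (f : hom X Y) (q : hom Y Z) :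
  is_cokernel f q -> is_cokernel (fmap Φ f) (fmap Φ q).
Proof.
move=> fq; split=> [|T t]; first by rewrite -fmap_comp (proj1 fq) fmap_zero.
have [R [ε εP]] := adjΦ T.
have ε_inj W (g g' : hom W R) : ε ∘ fmap Φ g = ε ∘ fmap Φ g' -> g = g'.
  by move=> e; have [h [_ hP]] := εP _ (ε ∘ fmap Φ g'); rewrite -(hP g) // -(hP g').
have [t0 [<- _]] := εP _ t.
rewrite -compA -fmap_comp -(compm0 _ ε) -(fmap_zero Φ).
move=> /ε_inj/(cokernel_desc fq)[h hq].
exists (ε ∘ fmap Φ h); split; first by rewrite -!compA -!fmap_comp hq.
move=> h'; have [h0 [<- _]] := εP _ h'; rewrite -!compA -!fmap_comp.
by move=> /ε_inj h0q; congr (_ ∘ fmap Φ _); apply: (cokernel_epi fq); rewrite h0q.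
Qed.

End Adjoint.

Section TrivialExtension.
Variables (B : abelian) (F : add_functor B B) (rexF : right_exact F).
Local Notation E := (trivial_extension rexF).

Definition U : add_functor E B.
Proof.
exists (fun X : E => under X) (fun (X Y : E) (f : hom X Y) => thom f).
- by [].
- by [].
- by move=> X Y f g; exact: thomD.
Defined.

Lemma U_inj (X Y : E) (f g : hom X Y) : fmap U f = fmap U g -> f = g.
Proof. exact: thom_inj. Qed.

Lemma U_act (X Y : E) (f : hom X Y) : fmap U f ∘ act X = act Y ∘ fmap F (fmap U f).
Proof. exact: (thomE f). Qed.

Definition Ulift (X Y : E) (a : hom (U X) (U Y)) (e : a ∘ act X = act Y ∘ fmap F a) :
  hom X Y := rtriv_mk e.

Lemma U_lift (X Y : E) (a : hom (U X) (U Y)) (e : a ∘ act X = act Y ∘ fmap F a) :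
  fmap U (Ulift e) = a.
Proof. by []. Qed.

Lemma U_mono (X Y : E) (f : hom X Y) : is_mono f <-> is_mono (fmap U f).
Proof.
split=> [|fm]; first exact: rtriv_mono.
by move=> T g h /(congr1 (fun x => fmap U x)); rewrite !fmap_comp => /fm/U_inj.
Qed.

Lemma U_epi (X Y : E) (f : hom X Y) : is_epi f <-> is_epi (fmap U f).
Proof.
split=> [|fm]; first exact: (rtriv_epi rexF).
by move=> T g h /(congr1 (fun x => fmap U x)); rewrite !fmap_comp => /fm/U_inj.
Qed.

Lemma U_kernel (X Y Z : E) (g : hom Y Z) (k : hom X Y) :
  is_kernel g k -> is_kernel (fmap U g) (fmap U k).
Proof.
move=> gk; have [K [k0 gk0]] := rtriv_has_ker (g : rtriv_hom Y Z).
have gk0' : @is_kernel E _ _ _ g k0 by exact: rtriv_ker.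
have [h kh] := kernel_lift gk (proj1 gk0').
apply: kernelI.
- by rewrite -fmap_comp (proj1 gk) fmap_zero.
- by apply/U_mono; exact: kernel_mono gk.
- move=> T t gt; have [s st] := kernel_lift gk0 gt.
  exists (fmap U h ∘ s); rewrite compA -fmap_comp kh; exact: st.
Qed.

Lemma U_short_exact (X Y Z : E) (i : hom X Y) (p : hom Y Z) :
  short_exact i p -> short_exact (fmap U i) (fmap U p).
Proof.
move=> ip; apply: short_exact_epi_ker; last exact: U_kernel (proj1 ip).
by apply/U_epi; exact: short_exact_epi ip.
Qed.

Lemma T_act (X : B) : act (T rexF X) = in2 (biprod X (F X)) ∘ fmap F (pr1 (biprod X (F X))).
Proof. by []. Qed.

Fact T_adj_subproof (X : B) (Y : E) (g : hom X (U Y)) :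
  row (biprod X (F X)) g (act Y ∘ fmap F g) ∘ act (T rexF X) =
  act Y ∘ fmap F (row (biprod X (F X)) g (act Y ∘ fmap F g)).
Proof.
rewrite T_act compA row_in2 fmapD !fmap_comp compDr !compA.
by rewrite act_act !comp0m addr0.
Qed.

Definition T_adj (X : B) (Y : E) (g : hom X (U Y)) : hom (T rexF X) Y :=
  Ulift (T_adj_subproof g).

Lemma U_T_adj (X : B) (Y : E) (g : hom X (U Y)) :
  fmap U (T_adj g) = row (biprod X (F X)) g (act Y ∘ fmap F g).
Proof. by []. Qed.

Lemma T_adj_in1 (X : B) (Y : E) (g : hom X (U Y)) :
  fmap U (T_adj g) ∘ in1 (biprod X (F X)) = g.
Proof. by rewrite U_T_adj row_in1. Qed.

(** The second injection is [act (T X) ∘ fmap F in1], so compatibility with the actions determines a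
    map out of [T X] from its restriction to [X]. *)
Lemma T_hom_in2 (X : B) (Y : E) (f : hom (T rexF X) Y) :
  fmap U f ∘ in2 (biprod X (F X)) = act Y ∘ fmap F (fmap U f ∘ in1 (biprod X (F X))).
Proof.
by rewrite fmap_comp compA -U_act T_act -!compA -fmap_comp pr1_in1 fmap1 compm1.
Qed.

Lemma T_hom_ext (X : B) (Y : E) (f g : hom (T rexF X) Y) :
  fmap U f ∘ in1 (biprod X (F X)) = fmap U g ∘ in1 (biprod X (F X)) -> f = g.
Proof.
move=> e; apply: U_inj; apply: (@biproduct_hom_ext _ _ _ _ (biprod X (F X))) => //.
by rewrite !T_hom_in2 e.
Qed.

Definition TF : add_functor B E.
Proof.
exists (T rexF) (fun X Y f => T_adj (in1 (biprod Y (F Y)) ∘ f : hom X (U (T rexF Y)))).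
- by move=> X; apply: T_hom_ext; cbv beta; rewrite T_adj_in1 compm1 fmap1 comp1m.
- move=> X Y Z g f; apply: T_hom_ext; cbv beta.
  by rewrite T_adj_in1 fmap_comp -compA T_adj_in1 !compA T_adj_in1.
- move=> X Y f g; apply: T_hom_ext; cbv beta.
  by rewrite T_adj_in1 fmapD compDl !T_adj_in1 compDr.
Defined.

Lemma TF_in1 (X Y : B) (f : hom X Y) :
  fmap U (fmap TF f) ∘ in1 (biprod X (F X)) = in1 (biprod Y (F Y)) ∘ f.
Proof. exact: T_adj_in1. Qed.

Lemma TF_in2 (X Y : B) (f : hom X Y) :
  fmap U (fmap TF f) ∘ in2 (biprod X (F X)) = in2 (biprod Y (F Y)) ∘ fmap F f.
Proof.
by rewrite T_hom_in2 TF_in1 fmap_comp compA T_act -(compA (in2 _)) -fmap_comp pr1_in1 fmap1 compm1.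
Qed.

Lemma TF_pr1 (X Y : B) (f : hom X Y) :
  pr1 (biprod Y (F Y)) ∘ fmap U (fmap TF f) = f ∘ pr1 (biprod X (F X)).
Proof.
apply: (@biproduct_hom_ext _ _ _ _ (biprod X (F X))); rewrite -!compA ?TF_in1 ?TF_in2.
  by rewrite pr1_in1K pr1_in1 compm1.
by rewrite pr1_in2K pr1_in2 compm0.
Qed.

Lemma TF_pr2 (X Y : B) (f : hom X Y) :
  pr2 (biprod Y (F Y)) ∘ fmap U (fmap TF f) = fmap F f ∘ pr2 (biprod X (F X)).
Proof.
apply: (@biproduct_hom_ext _ _ _ _ (biprod X (F X))); rewrite -!compA ?TF_in1 ?TF_in2.
  by rewrite pr2_in1K pr2_in1 compm0.
by rewrite pr2_in2K pr2_in2 compm1.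
Qed.

Lemma TF_left_adjoint : left_adjoint TF.
Proof.
move=> Y; exists (U Y), (T_adj (idm (U Y))) => X f.
have eE (g : hom X (U Y)) : fmap U (T_adj (idm (U Y)) ∘ fmap TF g) ∘ in1 _ = g.
  by rewrite fmap_comp -compA TF_in1 compA T_adj_in1 comp1m.
exists (fmap U f ∘ in1 _); split; first by apply: T_hom_ext; rewrite eE.
by move=> g <-; rewrite eE.
Qed.

(** Right exactness comes from the adjunction. The underlying map of [fmap TF i] is the direct sum
    of [i] and [fmap F i], which accounts for the hypothesis. *)
Lemma TF_short_exact (X Y Z : B) (i : hom X Y) (p : hom Y Z) :
  is_mono (fmap F i) -> short_exact i p -> short_exact (fmap TF i) (fmap TF p).
Proof.
move=> Fi ip; apply: short_exact_mono_coker; last first.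
  exact: left_adjoint_cokernel TF_left_adjoint _ _ _ _ _ (proj2 ip).
apply/U_mono/mono0 => W t it.
apply: (@biproduct_hom_ext' _ _ _ _ (biprod X (F X))); rewrite !compm0.
  apply: (monoP (short_exact_mono ip)).
  by rewrite compA -TF_pr1 -compA it compm0.
by apply: (monoP Fi); rewrite compA -TF_pr2 -compA it compm0.
Qed.

Lemma T_projective (P : B) : projective P -> projective (T rexF P).
Proof.
move=> Pproj X Y p f /U_epi pe.
have [g pg] := Pproj _ _ (fmap U p) (fmap U f ∘ in1 _) pe.
by exists (T_adj g); apply: T_hom_ext; rewrite fmap_comp -compA T_adj_in1.
Qed.

Lemma T_lift1 (X : B) (Y : E) : lift1 X (U Y) -> lift1 (T rexF X) Y.
Proof.
move=> XY V Z i p /U_short_exact ip f.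
have [g pg] := XY _ _ _ _ ip (fmap U f ∘ in1 _).
by exists (T_adj g); apply: T_hom_ext; rewrite fmap_comp -compA T_adj_in1.
Qed.

Hypothesis F2 : forall X : B, is_zero_ob (F (F X)).

Section CokernelOfAction.
Variables (Y : E) (Q : B) (q : hom (U Y) Q) (s : hom Q (U Y)).
Hypotheses (qP : is_cokernel (act Y) q) (qs : q ∘ s = idm Q).

(* F q is a cokernel of F (act Y), which starts at F (F Y) = 0. *)
Lemma fmap_section : fmap F s ∘ fmap F q = idm (F (U Y)).
Proof.
have [|h hq] := cokernel_desc (t := idm (F (U Y))) (rexF qP).
  by rewrite comp1m; exact: (proj1 (F2 (U Y) _)).
rewrite -hq -[h]compm1 -fmap1 -qs fmap_comp compA; congr (_ ∘ _).
by rewrite hq comp1m.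
Qed.

(** When [act Y] is mono, [s] splits [U Y] as [Q] plus [F (U Y)], and [fmap F s] identifies [F Q]
    with [F (U Y)] by [fmap_section]. *)
Lemma T_adj_iso : is_mono (act Y) -> is_iso (T_adj s).
Proof.
move=> am; have FqK : fmap F q ∘ fmap F s = idm (F Q) by rewrite -fmap_comp qs fmap1.
apply: mono_epi_iso.
  apply/U_mono/mono0 => W t; rewrite U_T_adj compDl => e.
  have t1 : pr1 (biprod Q (F Q)) ∘ t = 0.
    have := congr1 (comp q) e; rewrite compDr !compA qs comp1m (proj1 qP).
    by rewrite !comp0m addr0 compm0.
  apply: (@biproduct_hom_ext' _ _ _ _ (biprod Q (F Q))); rewrite !compm0 //.
  move: e; rewrite -compA t1 compm0 add0r -!compA => /(monoP am) e.
  by rewrite -[pr2 _ ∘ t]comp1m -FqK -compA e compm0.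
apply: epi0 => W t ts.
have tS : fmap U t ∘ s = 0.
  by rewrite -(T_adj_in1 s) compA -fmap_comp ts fmap_zero comp0m.
have Ft : fmap F (fmap U t) = 0.
  by rewrite -[LHS]compm1 -fmap_section compA -fmap_comp tS fmap_zero comp0m.
have [|t' tq] := cokernel_desc (t := fmap U t) qP; first by rewrite U_act Ft compm0.
by apply: U_inj; rewrite fmap_zero -tq -[t']compm1 -qs compA tq tS comp0m.
Qed.

End CokernelOfAction.

(** [fmap F (pr1 S)] is invertible, since the other summand of [F (X ⊕ F X)] is [F (F X) = 0]. *)
Lemma T_act_mono (X : B) : is_mono (act (T rexF X)).
Proof.
rewrite T_act; set S := biprod _ _; apply: mono_comp; first exact: mono_split (pr2_in2 S).
apply: (@mono_split _ _ _ _ (fmap F (in1 S))).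
rewrite -fmap_comp -fmap1 -(in_pr S) fmapD [in X in _ + X]fmap_comp.
by rewrite (proj2 (F2 X (F S)) (fmap F (pr2 S))) compm0 addr0.
Qed.

Lemma T_act_cokernel (X : B) : is_cokernel (act (T rexF X)) (pr1 (biprod X (F X))).
Proof.
rewrite T_act; set S := biprod _ _; apply: cokernelI.
- by rewrite pr1_in2K.
- exact: epi_split (pr1_in1 S).
- move=> W t; rewrite compA => t2; exists (t ∘ in1 S).
  apply: (@biproduct_hom_ext _ _ _ _ S); first by rewrite (comp_1 _ (pr1_in1 S)).
  rewrite (comp_0 _ (pr1_in2 S)) -[in2 S]compm1 -fmap1 -(pr1_in1 S) fmap_comp !compA t2.
  by rewrite comp0m.
Qed.

(** The retraction passes to the cokernels of the actions, those being [Q] and [X]. It also gives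
    the hypotheses of [T_adj_iso]: [act Y] becomes a restriction of the mono [act (T X)], and [q] is
    split through [X]. *)
Lemma T_class_retract (X : B) (Y : E) (a : hom Y (T rexF X)) (b : hom (T rexF X) Y) :
  b ∘ a = idm Y -> exists Q (u : hom Q X) (v : hom X Q),
    v ∘ u = idm Q /\ isomorphic Y (T rexF Q).
Proof.
move=> ba; have baU : fmap U b ∘ fmap U a = idm (U Y) by rewrite -fmap_comp ba fmap1.
have [Q [q qP]] := @has_cokernels B (F (U Y)) (U Y) (act Y); set S := biprod X (F X).
have [|u uq] := cokernel_desc (t := pr1 S ∘ fmap U a) qP.
  by rewrite -compA (U_act a) compA (proj1 (T_act_cokernel X)) comp0m.
have [|v vp] := cokernel_desc (t := q ∘ fmap U b) (T_act_cokernel X).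
  by rewrite -compA (U_act b) compA (proj1 qP) comp0m.
have vu : v ∘ u = idm Q.
  apply: (cokernel_epi qP); rewrite -compA uq compA vp -compA baU.
  by rewrite compm1 comp1m.
have qs : q ∘ (fmap U b ∘ in1 S ∘ u) = idm Q.
  by rewrite !compA -vp -[v ∘ _ ∘ _]compA pr1_in1 compm1.
exists Q, u, v; split=> //.
have [|f [fg gf]] := T_adj_iso qP qs; last by exists f, (T_adj (fmap U b ∘ in1 S ∘ u)).
apply: (@mono_of_comp _ _ _ _ (fmap U a)); rewrite U_act.
apply: mono_comp; first exact: T_act_mono.
by apply: (@mono_split _ _ _ _ (fmap F (fmap U b))); rewrite -fmap_comp baU fmap1.
Qed.

End TrivialExtension.

(** * Cotorsion pairs *)

Section CotorsionPairs.
Variables (A : abelian) (C D : set A).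
Hypotheses (epA : enough_projectives A) (hCD : hereditary_complete_cotorsion_pair C D).
Implicit Types X Y : A.

Lemma cotorsion_ext1 X Y : C X -> D Y -> ext1 X Y.
Proof.
by case: hCD => -[CE _] _ _; rewrite {1}CE => /[apply] /(ext1P epA).
Qed.

Lemma cotorsion_left X : (forall Y, D Y -> ext1 X Y) -> C X.
Proof.
by case: hCD => -[CE _] _ _ XD; rewrite CE => Y /XD /(ext1P epA).
Qed.

Lemma cotorsion_right Y : (forall X, C X -> ext1 X Y) -> D Y.
Proof.
by case: hCD => -[_ DE] _ _ CY; rewrite DE => X /CY /(ext1P epA).
Qed.

Lemma cotorsion_left_retract X X' (u : hom X X') (v : hom X' X) :
  v ∘ u = idm X -> C X' -> C X.
Proof.
move=> vu CX; apply: cotorsion_left => Y DY.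
by apply: ext1_retractl vu _; exact: cotorsion_ext1.
Qed.

Lemma cotorsion_right_retract Y Y' (u : hom Y Y') (v : hom Y' Y) :
  v ∘ u = idm Y -> D Y' -> D Y.
Proof.
move=> vu DY; apply: cotorsion_right => X CX.
by apply: ext1_retractr vu _; exact: cotorsion_ext1.
Qed.

Lemma cotorsion_left_extension X1 X X2 (i : hom X1 X) (q : hom X X2) :
  short_exact i q -> C X1 -> C X2 -> C X.
Proof.
move=> iq C1 C2; apply: cotorsion_left => Y DY.
by apply: ext1_extensionl iq _ _; exact: cotorsion_ext1.
Qed.

Lemma cotorsion_right_extension Y1 Y Y2 (i : hom Y1 Y) (q : hom Y Y2) :
  short_exact i q -> D Y1 -> D Y2 -> D Y.
Proof.
move=> iq D1 D2; apply: cotorsion_right => X CX.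
by apply: ext1_extensionr iq _ _; exact: cotorsion_ext1.
Qed.

(** Heredity in degree 2 on [X] is orthogonality in degree 1 on [K]. *)
Lemma cotorsion_left_syzygy X P K (k : hom K P) (p : hom P X) :
  projective P -> short_exact k p -> C X -> C K.
Proof.
move=> Pproj kp CX; apply: cotorsion_left => Y DY; apply/(ext1P epA).
have [_ _ hered] := hCD.
by have /ExtS_shift XY := hered 1%N X Y CX DY; exact: XY Pproj kp.
Qed.

Lemma cotorsion_cover X : exists Y Z (i : hom Y Z) (p : hom Z X),
  [/\ short_exact i p, D Y & C Z].
Proof. by have [_ /(_ X)[]] := hCD. Qed.

Lemma cotorsion_envelope X : exists Y Z (i : hom X Y) (p : hom Y Z),
  [/\ short_exact i p, D Y & C Z].
Proof. by have [_ /(_ X)[]] := hCD. Qed.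

End CotorsionPairs.

(** * Transfer of a cotorsion pair to the trivial extension *)

Section TrivialExtensionCotorsion.
Variables (B : abelian) (F : add_functor B B) (rexF : right_exact F).
Hypotheses (epB : enough_projectives B) (F2 : forall X : B, is_zero_ob (F (F X))).
Local Notation E := (trivial_extension rexF).
Variables C D : set B.
Hypothesis hCD : hereditary_complete_cotorsion_pair C D.
Hypotheses (L1C : forall X, C X -> L1_zero F X) (FC : forall X, C X -> D (F X)).

Let epE : enough_projectives E := trivial_extension_enough_projectives epB.

Lemma T_class_T (X : B) : C X -> T_class (rexF := rexF) C (T rexF X).
Proof. by move=> CX; exists X => //; exists (idm _), (idm _); rewrite comp1m. Qed.

Lemma TF_short_exact_class (X Y Z : B) (i : hom X Y) (p : hom Y Z) :
  C Z -> short_exact i p -> short_exact (fmap (TF rexF) i) (fmap (TF rexF) p).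
Proof.
move=> CZ ip; apply: TF_short_exact => //.
exact: (L1_zero_mono epB rexF (L1C CZ) ip).
Qed.

Lemma T_class_ext1 (X Y : E) : T_class C X -> D (U rexF Y) -> ext1 X Y.
Proof.
move=> [X0 CX0 [f [g [gf _]]]] DY; apply: (ext1_retractl gf).
apply/lift1_ext1/T_lift1/ext1_lift1.
exact (cotorsion_ext1 epB hCD CX0 DY).
Qed.

(** A cover [π] of [U Y] has an adjoint [T X] → [Y], whose kernel is an extension of [F X] by the
    kernel [K0] of [π]. Both ends lie in [D]. *)
Lemma T_cover (Y : E) : exists X (K : E) (k : hom K (T rexF X)) (p : hom (T rexF X) Y),
  [/\ short_exact k p, D (U rexF K) & C X].
Proof.
have [K0 [X [d [π [dπ DK0 CX]]]]] := cotorsion_cover hCD (U rexF Y).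
pose S := biprod X (F X).
have pe : is_epi (T_adj π).
  apply/U_epi; apply: (@epi_of_comp _ _ _ _ _ (in1 S)); rewrite T_adj_in1.
  exact: short_exact_epi dπ.
have [K [k kp]] := epi_short_exact pe; exists X, K, k, (T_adj π); split=> //.
have Ukp := U_short_exact kp.
have [|d' kd] := kernel_lift (t := in1 S ∘ d) (proj1 Ukp).
  by rewrite compA T_adj_in1 (short_exact_comp0 dπ).
suff ses : short_exact d' (pr2 S ∘ fmap (U rexF) k).
  exact: (cotorsion_right_extension epB hCD ses DK0 (FC CX)).
apply: short_exact_epi_ker; last first.
  apply: kernelI.
  - by rewrite -compA kd pr2_in1K.
  - apply: (@mono_of_comp _ _ _ _ (fmap (U rexF) k)); rewrite kd.
    exact: mono_comp (mono_split (pr1_in1 S)) (short_exact_mono dπ).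
  - move=> W t t2.
    have t1 : fmap (U rexF) k ∘ t = in1 S ∘ (pr1 S ∘ (fmap (U rexF) k ∘ t)).
      apply: (@biproduct_hom_ext' _ _ _ _ S); first by rewrite pr1_in1K.
      by rewrite pr2_in1K compA.
    have [|s ds] := kernel_lift (t := pr1 S ∘ (fmap (U rexF) k ∘ t)) (proj1 dπ).
      by rewrite -{1}(T_adj_in1 π) -compA -t1 compA (short_exact_comp0 Ukp) comp0m.
    by exists s; apply: (short_exact_mono Ukp); rewrite compA kd t1 -ds compA.
apply: epi0 => W w wk.
(* An element [c] of [F X] is completed to the element [(x, c)] of the kernel, where [π x] must
   cancel the contribution of [c]. *)
have [V [c [x [ce πx]]]] :=
  epi_cover (- (act Y ∘ fmap F π : hom (F X) (U rexF Y))) (short_exact_epi dπ).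
have [|y ky] := kernel_lift (t := col S x c) (proj1 Ukp).
  by rewrite U_T_adj row_col πx compNm addNr.
apply: (epiP ce); rewrite -(pr2_col S x c) -ky !compA -[w ∘ _ ∘ _]compA wk.
by rewrite comp0m.
Qed.

(** [T] is applied to an envelope of [U Y] in [B], and the result is pushed out along the counit
    [T (U Y)] → [Y]. The part [L] of [U Z] over the summand [X] of [T X] is again an extension of
    [X] by [U Y]; it is compared with the envelope [G]. So [U Z] is an extension of [F X] by a copy
    of [G]. *)
Lemma T_envelope (Y : E) : exists (Z : E) X (i : hom Y Z) (p : hom Z (T rexF X)),
  [/\ short_exact i p, D (U rexF Z) & C X].
Proof.
have [G [X [j [π [jπ DG CX]]]]] := cotorsion_envelope hCD (U rexF Y).
have Tjπ := TF_short_exact_class CX jπ.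
have [Z [c [i P]]] := pushout_exists (fmap (TF rexF) j) (T_adj (idm (U rexF Y))).
have [p [pc ip]] := pushout_short_exact P Tjπ.
exists Z, X, i, p; split=> //.
have Uip := U_short_exact ip.
pose S := biprod X (F X).
have qe : is_epi (pr2 S ∘ fmap (U rexF) p).
  by apply: epi_comp (epi_split (pr2_in2 S)) (short_exact_epi Uip).
have [L [l lq]] := epi_short_exact qe.
suff DL : D L by exact: (cotorsion_right_extension epB hCD lq DL (FC CX)).
have pcU : fmap (U rexF) p ∘ fmap (U rexF) c = fmap (U rexF) (fmap (TF rexF) π).
  by rewrite -fmap_comp pc.
have [|g lg] := kernel_lift (t := fmap (U rexF) c ∘ in1 (biprod G (F G))) (proj1 lq).
  by rewrite -compA [fmap _ p ∘ _]compA pcU TF_in1 pr2_in1K.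
have [|i' li] := kernel_lift (t := fmap (U rexF) i) (proj1 lq).
  by rewrite -compA (short_exact_comp0 Uip) compm0.
have i'p : short_exact i' (pr1 S ∘ fmap (U rexF) p ∘ l).
  apply: short_exact_epi_ker; last first.
    apply: kernelI.
    - by rewrite -compA li -compA (short_exact_comp0 Uip) compm0.
    - by apply: (@mono_of_comp _ _ _ _ l); rewrite li; exact: short_exact_mono Uip.
    - move=> W t t1; have [|s is_] := kernel_lift (t := l ∘ t) (proj1 Uip).
        apply: (@biproduct_hom_ext' _ _ _ _ S); rewrite !compA ?t1 ?compm0 //.
        by rewrite (short_exact_comp0 lq) comp0m.
      by exists s; apply: (short_exact_mono lq); rewrite compA li.
  apply: (@epi_of_comp _ _ _ _ _ g).
  rewrite -compA lg -compA [fmap _ p ∘ _]compA pcU TF_in1 pr1_in1K.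
  exact: short_exact_epi jπ.
have [g' [g'g gg']] : is_iso g.
  apply: (short_five jπ i'p).
    apply: (short_exact_mono lq); rewrite compA lg li -compA -TF_in1 compA.
    by rewrite -fmap_comp (proj1 P) fmap_comp -compA T_adj_in1 compm1.
  by rewrite -compA lg -compA [fmap _ p ∘ _]compA pcU TF_in1 pr1_in1K.
exact: (cotorsion_right_retract epB hCD gg' DG).
Qed.

(** The cover of [X] splits, which makes [X] a retract of some [T X0]. *)
Lemma T_class_left (X : E) : (forall Y : E, D (U rexF Y) -> ext1 X Y) -> T_class C X.
Proof.
move=> XD; have [X0 [K [k [p [kp DK CX0]]]]] := T_cover X.
have [a pa] := ext1_lift1 (XD _ DK) kp (idm X).
have [Q [u [v [vu XQ]]]] := T_class_retract F2 pa.
by exists Q => //; exact: (cotorsion_left_retract epB hCD vu CX0).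
Qed.

(** An extension problem over [X] in [C] is sent by [T] to a short exact sequence ending in [T X];
    the solution there restricts along [in1]. *)
Lemma T_class_right (Y : E) : (forall X, T_class C X -> ext1 X Y) -> D (U rexF Y).
Proof.
move=> CY; apply: (cotorsion_right epB hCD) => X CX K V k p kp f.
have [g gk] := CY _ (T_class_T CX) _ _ _ _ (TF_short_exact_class CX kp) (T_adj f).
exists (fmap (U rexF) g ∘ in1 _).
by rewrite -compA -TF_in1 compA -fmap_comp gk T_adj_in1.
Qed.

(** Dimension shifting: [T] turns a projective presentation of [X0] into one of [T X0], and the
    syzygy of [X0] stays in [C]. *)
Lemma T_hereditary : hereditary (T_class (rexF := rexF) C) (U_preimage D).
Proof.
elim=> [|n IH] X Y CX DY; first by apply/(ext1P epE); exact: T_class_ext1.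
have [X0 CX0 [f [g [gf fg]]]] := CX.
have [P [K [k [p [Pproj kp]]]]] := proj_cover epB X0.
have CK := cotorsion_left_syzygy epB hCD Pproj kp CX0.
have Tkp : short_exact (fmap (TF rexF) k) (g ∘ fmap (TF rexF) p).
  have Tkp := TF_short_exact_class CX0 kp.
  apply: short_exact_epi_ker.
    exact: epi_comp (epi_split gf) (short_exact_epi Tkp).
  exact: kernel_comp_mono (mono_split fg) (proj1 Tkp).
apply: (ExtS_cover epE (T_projective Pproj) Tkp).
exact: IH (T_class_T CK) DY.
Qed.

Lemma T_cotorsion :
  hereditary_complete_cotorsion_pair (T_class (rexF := rexF) C) (U_preimage D).
Proof.
split; last exact: T_hereditary.
- split; apply/seteqP; split=> [X CX Y DY|X XP].
  + exact: T_hereditary.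
  + by apply: T_class_left => Y /XP /(ext1P epE).
  + exact: T_hereditary.
  + by apply: T_class_right => Y /XP /(ext1P epE).
- move=> X; split.
    have [X0 [K [k [p [kp DK CX0]]]]] := T_cover X.
    by exists K, (T rexF X0), k, p; split=> //; exact: T_class_T.
  have [Z [X0 [i [p [ip DZ CX0]]]]] := T_envelope X.
  by exists Z, (T rexF X0), i, p; split=> //; exact: T_class_T.
Qed.

End TrivialExtensionCotorsion.

Lemma fmap_iso (A A' : preadditive) (Φ : add_functor A A') (X Y : A) :
  isomorphic X Y -> isomorphic (Φ X) (Φ Y).
Proof.
by move=> [f [g [gf fg]]]; exists (fmap Φ f), (fmap Φ g); rewrite -!fmap_comp gf fg !fmap1.
Qed.

Section ThickClasses.
Variables (A : abelian) (W : set A).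
Hypothesis thickW : thick W.

Lemma thick_summand (X Y : A) (S : biproduct X Y) : W S -> W X /\ W Y.
Proof. exact: (proj1 thickW). Qed.

Lemma thick_biproduct (X Y : A) (S : biproduct X Y) : W X -> W Y -> W S.
Proof.
by move=> WX WY; have [_ + _] := proj2 thickW _ _ _ _ _ (biproduct_short_exact S); apply.
Qed.

(** Closure under isomorphism is not part of [thick]; it is derived by presenting [Y] as a biproduct
    of [X] and a zero object. *)
Lemma thick_iso (X Y : A) : isomorphic X Y -> W Y -> W X.
Proof.
move=> [f [g [gf fg]]]; have [Z ZP] := has_zero A.
suff [S <-] : exists S : biproduct X Z, bp S = Y by case/thick_summand.
unshelve eexists.
  exists Y f 0 g 0.
  - exact: gf.
  - by apply: esym; rewrite comp0m; exact: (proj1 (ZP Z)).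
  - exact: compm0.
  - exact: comp0m.
  - by rewrite comp0m addr0.
by [].
Qed.

End ThickClasses.

(** * The Hovey triple on the trivial extension *)

Section HoveyTriple.
Variables (B : abelian) (F : add_functor B B) (rexF : right_exact F).
Hypotheses (epB : enough_projectives B) (F2 : forall X : B, is_zero_ob (F (F X))).
Variable M : triple B.
Hypotheses (hM : hereditary_Hovey_triple M) (L1F : forall X, cof M X -> L1_zero F X).
Hypothesis FC : forall X, cof M X -> (fib M `&` triv M) (F X).
Local Notation E := (trivial_extension rexF).

(** The underlying object of [T X0] is [X0 ⊕ F X0] with [F X0] trivial, so it is trivial exactly
    when [X0] is. *)
Lemma T_class_triv :
  T_class (rexF := rexF) (cof M) `&` U_preimage (triv M) = T_class (cof M `&` triv M).
Proof.
have [_ _ thickW] := hM; apply/seteqP; split=> X.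
  move=> [[X0 CX0 [f [g [gf fg]]]] WX]; exists X0; last by exists f, g.
  split=> //; suff : triv M (biprod X0 (F X0)) by case/(thick_summand thickW).
  by apply: (thick_iso thickW) WX; apply: (@fmap_iso _ _ (U rexF) (T rexF X0)); exists g, f.
move=> [X0 [CX0 WX0] [f [g [gf fg]]]]; split; first by exists X0 => //; exists f, g.
suff WT : triv M (biprod X0 (F X0)).
  by apply: (thick_iso thickW) WT; apply: (@fmap_iso _ _ (U rexF) _ (T rexF X0)); exists f, g.
by apply: thick_biproduct => //; case: (FC CX0).
Qed.

Lemma U_preimage_thick : thick (U_preimage (rexF := rexF) (triv M)).
Proof.
have [_ _ thickW] := hM; split.
  by move=> X Y S WS; exact: (thick_summand thickW (S := fmap_biproduct (U rexF) S)).
move=> X Y Z i p /U_short_exact; exact: (proj2 thickW).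
Qed.

Theorem rtriv_Hovey_triple : hereditary_Hovey_triple (rtriv_triple rexF M).
Proof.
have [hCW hCF _] := hM; split; last exact: U_preimage_thick.
  rewrite [cof _ `&` _]T_class_triv; apply: T_cotorsion => // X [CX _]; first exact: L1F.
  by case: (FC CX).
exact: (T_cotorsion rexF epB F2 hCF L1F FC).
Qed.

End HoveyTriple.

(** * Triangle equivalences *)

(** Morphisms are taken up to [≈], so equational reasoning below is setoid rewriting. *)
#[local] Instance meq_equivalence (C : category) (X Y : C) : Equivalence (@meq C X Y).
Proof. split; [exact: meq_refl|exact: meq_sym|exact: meq_trans]. Qed.

#[local] Instance mcomp_proper (C : category) (X Y Z : C) :
  Proper (@meq C Y Z ==> @meq C X Y ==> @meq C X Z) (@mcomp C X Y Z).
Proof. by move=> g g' gg f f' ff; exact: meq_comp. Qed.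

#[local] Instance onmor_proper (C C' : category) (G : functor C C') (X Y : C) :
  Proper (@meq C X Y ==> @meq C' (G X) (G Y)) (@onmor C C' G X Y).
Proof. by move=> f f' ff; exact: onmor_eq. Qed.

#[local] Hint Resolve meq_refl : core.

Section Isomorphisms.
Variable C : category.
Implicit Types X Y Z : C.

Lemma equiv_mor_id X : is_equiv_mor (mid X).
Proof. by exists (mid X); split; exact: mcomp1m. Qed.

Lemma equiv_mor_comp X Y Z (g : mor Y Z) (f : mor X Y) :
  is_equiv_mor g -> is_equiv_mor f -> is_equiv_mor (g ⊙ f).
Proof.
move=> [g' [g'g gg']] [f' [f'f ff']]; exists (f' ⊙ g'); split.
  by rewrite mcompA -(mcompA f') g'g mcompm1 f'f.
by rewrite mcompA -(mcompA g) ff' mcompm1 gg'.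
Qed.

Lemma equiv_mor_cancell X Y Z (g : mor Y Z) (f f' : mor X Y) :
  is_equiv_mor g -> g ⊙ f ≈ g ⊙ f' -> f ≈ f'.
Proof.
move=> [g' [g'g _]] e.
by rewrite -(mcomp1m f) -(mcomp1m f') -g'g -!mcompA e.
Qed.

Lemma equiv_mor_cancelr X Y Z (g g' : mor Y Z) (f : mor X Y) :
  is_equiv_mor f -> g ⊙ f ≈ g' ⊙ f -> g ≈ g'.
Proof.
move=> [f' [_ ff']] e.
by rewrite -(mcompm1 g) -(mcompm1 g') -ff' !mcompA e.
Qed.

Lemma equiv_mor_eq X Y (f g : mor X Y) : f ≈ g -> is_equiv_mor f -> is_equiv_mor g.
Proof. by move=> fg [h [hf fh]]; exists h; rewrite -fg. Qed.

Lemma equiv_mor_factor X Y Z (g : mor Y Z) (f : mor X Y) :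
  is_equiv_mor g -> is_equiv_mor (g ⊙ f) -> is_equiv_mor f.
Proof.
move=> gi; have [g' [g'g gg']] := gi; move=> [h [hgf gfh]].
exists (h ⊙ g); split; first by rewrite -mcompA.
by apply: (equiv_mor_cancell gi); rewrite 2!mcompA gfh mcomp1m mcompm1.
Qed.

Lemma onmor_equiv_mor (C' : category) (G : functor C C') X Y (f : mor X Y) :
  is_equiv_mor f -> is_equiv_mor (onmor G f).
Proof. by move=> [g [gf fg]]; exists (onmor G g); rewrite -!onmor_comp gf fg !onmor1. Qed.

End Isomorphisms.

Section TriangleIso.
Variables (C : category) (S : functor C C).

Lemma tri_iso_sym (t t' : triangle S) : tri_iso t t' -> tri_iso t' t.
Proof.
move=> [a [b [c [[ia ib ic] [s1 s2 s3]]]]].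
have [[a' [a'a aa']] [[b' [b'b bb']] [c' [c'c cc']]]] := (ia, (ib, ic)).
exists a', b', c'; split; first by split; [exists a|exists b|exists c].
split.
- by apply: (equiv_mor_cancell ib); rewrite 2!mcompA s1 bb' -mcompA aa' mcompm1 mcomp1m.
- by apply: (equiv_mor_cancell ic); rewrite 2!mcompA s2 cc' -mcompA bb' mcompm1 mcomp1m.
- apply: (equiv_mor_cancell (onmor_equiv_mor S ia)).
  by rewrite 2!mcompA s3 -onmor_comp aa' onmor1 -mcompA cc' mcompm1 mcomp1m.
Qed.

End TriangleIso.

Lemma distinguished_iff (C : category) (D : tri_structure C) (t t' : triangle (shift D)) :
  tri_iso t t' -> distinguished t <-> distinguished t'.
Proof. by move=> tt'; split; apply: distinguished_iso => //; exact: tri_iso_sym. Qed.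

Section NaturalIso.
Variables C C' : category.

Lemma nat_iso_inv (G H : functor C C') eta :
  is_nat_iso (F := G) (G := H) eta -> exists eta', is_nat_iso (F := H) (G := G) eta'.
Proof.
move=> [ei en]; exists (fun X => sval (cid (ei X))); split=> [X|X Y f].
  by case: cid => /= g [gf fg]; exists (eta X).
case: cid => /= g [ge eg]; case: cid => /= h [he eh].
apply: (equiv_mor_cancell (ei Y)).
by rewrite 2!mcompA eg mcomp1m en -mcompA eh mcompm1.
Qed.

Variable G : functor C C'.
Hypothesis equivG : is_equivalence G.

Lemma equivalence_faithful (X Y : C) (f g : mor X Y) : onmor G f ≈ onmor G g -> f ≈ g.
Proof.
move: equivG => [H [[eta [ei en]] _]] fg.
by apply: (equiv_mor_cancell (ei Y)); rewrite !en /= fg.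
Qed.

(** The unit and counit are not assumed to satisfy triangle identities. The unit gives [g] with the
    same image under [H] as [f], and the counit then removes [H]. *)
Lemma equivalence_full (X Y : C) (f : mor (G X) (G Y)) : exists g, onmor G g ≈ f.
Proof.
move: equivG => [H [[eta [ei en]] [eps [pi pn]]]].
have [h [he eh]] := ei Y; exists (h ⊙ (onmor H f ⊙ eta X)).
set g := _ ⊙ _.
have e : onmor H (onmor G g) ≈ onmor H f.
  apply: (equiv_mor_cancelr (ei X)).
  have /= <- := en _ _ g.
  by rewrite mcompA eh mcomp1m.
apply: (equiv_mor_cancelr (pi (G X))).
have /= <- := pn _ _ (onmor G g); have /= <- := pn _ _ f.
by rewrite e.
Qed.

Lemma equivalence_reflects_iso (X Y : C) (f : mor X Y) :
  is_equiv_mor (onmor G f) -> is_equiv_mor f.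
Proof.
move=> [g' [g'f fg']]; have [g gE] := equivalence_full g'.
exists g; split; apply: equivalence_faithful; rewrite onmor_comp gE onmor1 //.
Qed.

End NaturalIso.

Section TriangleEquivalence.

Lemma triangle_equivalence_inv (C C' : category) (D : tri_structure C)
    (D' : tri_structure C') (G : functor C C') :
  triangle_equivalence D D' G -> exists H, triangle_equivalence D' D H.
Proof.
move=> [equivG [xi [[xi_iso xi_nat] distG]]].
have [H [[eta etaP] [eps epsP]]] := equivG.
have [eps_iso eps_nat] := epsP.
have equivH : is_equivalence H.
  exists G; split; first by have [e eP] := nat_iso_inv epsP; exists e.
  by have [e eP] := nat_iso_inv etaP; exists e.
have s_iso Y : is_equiv_mor (onmor (shift D') (eps Y) ⊙ xi (H Y)).
  by apply: equiv_mor_comp _ (xi_iso _); exact: (onmor_equiv_mor _ (eps_iso Y)).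
(* The shift comparison for [H] is defined by this equation, which is exactly what makes [eps] an
   isomorphism of triangles from [G (H t)] to [t] at the end. *)
have exi Y : exists x : mor (H (shift D' Y)) (shift D (H Y)),
    (onmor (shift D') (eps Y) ⊙ xi (H Y)) ⊙ onmor G x ≈ eps (shift D' Y).
  have [s' [s's ss']] := s_iso Y.
  have [x xE] := equivalence_full equivG (s' ⊙ eps (shift D' Y)).
  exists x; rewrite xE mcompA ss' mcomp1m //.
pose x Y := sval (cid (exi Y)).
have xE Y : (onmor (shift D') (eps Y) ⊙ xi (H Y)) ⊙ onmor G (x Y) ≈ eps (shift D' Y).
  exact: (svalP (cid (exi Y))).
exists H; split=> //; exists x; split; first split=> [Y|Y Y' f].
- apply: (equivalence_reflects_iso equivG); apply: (equiv_mor_factor (s_iso Y)).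
  by apply: equiv_mor_eq (eps_iso _); symmetry; exact: xE.
- apply: (equivalence_faithful equivG); apply: (equiv_mor_cancell (s_iso Y')) => /=.
  rewrite !onmor_comp mcompA xE.
  have /= -> := eps_nat _ _ (onmor (shift D') f).
  rewrite mcompA -(mcompA _ (xi (H Y'))).
  have /= -> := xi_nat _ _ (onmor H f).
  rewrite mcompA -onmor_comp.
  have /= -> := eps_nat _ _ f.
  by rewrite onmor_comp -!mcompA -xE !mcompA.
move=> t; transitivity (distinguished (map_triangle xi (map_triangle x t))).
  apply: distinguished_iff; apply: tri_iso_sym.
  exists (eps (v1 t)), (eps (v2 t)), (eps (v3 t)); split; first by split; exact: eps_iso.
  split; [exact: eps_nat|exact: eps_nat|].
  rewrite /= onmor_comp !mcompA xE; exact: eps_nat.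
by symmetry; exact: distG.
Qed.

Lemma triangle_equivalence_comp (C1 C2 C3 : category) (D1 : tri_structure C1)
    (D2 : tri_structure C2) (D3 : tri_structure C3) (G : functor C2 C3) (H : functor C1 C2) :
  triangle_equivalence D2 D3 G -> triangle_equivalence D1 D2 H ->
  triangle_equivalence D1 D3 (functor_comp G H).
Proof.
move=> [[G' [[a [ai an]] [b [bi bn]]]] [xi [[xi_iso xi_nat] distG]]].
move=> [[H' [[c [ci cn]] [d [di dn]]]] [zeta [[zeta_iso zeta_nat] distH]]].
split.
  exists (functor_comp H' G'); split.
    exists (fun X => onmor H' (a (H X)) ⊙ c X); split=> [X|X Y f] /=.
      by apply: equiv_mor_comp _ (ci X); exact: (onmor_equiv_mor _ (ai (H X))).
    have /= cN := cn _ _ f; have /= aN := an _ _ (onmor H f).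
    by rewrite -mcompA cN mcompA -onmor_comp aN onmor_comp -mcompA.
  exists (fun X => b X ⊙ onmor G (d (G' X))); split=> [X|X Y f] /=.
    by apply: equiv_mor_comp (bi X) _; exact: (onmor_equiv_mor _ (di (G' X))).
  have /= dN := dn _ _ (onmor G' f); have /= bN := bn _ _ f.
  by rewrite -mcompA -onmor_comp dN onmor_comp mcompA bN -mcompA.
exists (fun X => xi (H X) ⊙ onmor G (zeta X)); split.
  split=> [X|X Y f] /=.
    by apply: equiv_mor_comp (xi_iso _) _; exact: (onmor_equiv_mor _ (zeta_iso X)).
  have /= zN := zeta_nat _ _ f; have /= xN := xi_nat _ _ (onmor H f).
  by rewrite -mcompA -onmor_comp zN onmor_comp mcompA xN -mcompA.
move=> t; rewrite distH distG; apply: distinguished_iff.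
exists (mid _), (mid _), (mid _); split; first by split; exact: equiv_mor_id.
split=> /=; rewrite ?onmor1 ?mcomp1m ?mcompm1 //.
by rewrite onmor_comp mcompA.
Qed.

End TriangleEquivalence.

(** * Functors between stable categories *)

Section HullMaps.
Variables (A : preadditive) (M : triple A).

(* f induces h between the cokernels of two hulls: the relation that determines
   the shift of a stable map. *)
Definition hull_map (X I Z X' I' Z' : A) (i : hom X I) (p : hom I Z) (i' : hom X' I')
    (p' : hom I' Z') (f : hom X X') (h : hom Z Z') :=
  exists g : hom I I', g ∘ i = i' ∘ f /\ h ∘ p = p' ∘ g.

Lemma hull_map_comp (X I Z X' I' Z' X'' I'' Z'' : A) (i : hom X I) (p : hom I Z)
    (i' : hom X' I') (p' : hom I' Z') (i'' : hom X'' I'') (p'' : hom I'' Z'')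
    (f : hom X X') (h : hom Z Z') (f' : hom X' X'') (h' : hom Z' Z'') :
  hull_map i' p' i'' p'' f' h' -> hull_map i p i' p' f h ->
  hull_map i p i'' p'' (f' ∘ f) (h' ∘ h).
Proof.
move=> [g' [gi' hp']] [g [gi hp]]; exists (g' ∘ g); split.
  by rewrite -compA gi compA gi' compA.
by rewrite -compA hp compA hp' compA.
Qed.

Lemma hull_map_id (X I Z : A) (i : hom X I) (p : hom I Z) :
  hull_map i p i p (idm X) (idm Z).
Proof. by exists (idm I); rewrite !comp1m !compm1. Qed.

(** Injectivity in the Frobenius category, but with [X] and [Y] arbitrary; vanishing of Ext^1
    between cofibrant and trivially fibrant objects gives this form. *)
Definition relatively_injective := forall (X Y Z I : A) (i : hom X Y) (p : hom Y Z),
  short_exact i p -> (cof M `&` fib M) Z -> proj_inj M I ->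
  forall f : hom X I, exists g : hom Y I, g ∘ i = f.

Hypothesis injM : relatively_injective.

Lemma stable_eq_refl (X Y : A) (f : hom X Y) : stable_eq M f f.
Proof. by rewrite /stable_eq subrr; constructor. Qed.

Lemma factors_proj_inj (X Y P : A) (a : hom X P) (b : hom P Y) :
  proj_inj M P -> factors M (b ∘ a).
Proof. by move=> PP; rewrite -[b ∘ a]addr0; constructor=> //; constructor. Qed.

Lemma factors_extend (X I Z Y : A) (i : hom X I) (p : hom I Z) (f : hom X Y) :
  short_exact i p -> (cof M `&` fib M) Z -> factors M f ->
  exists g : hom I Y, g ∘ i = f.
Proof.
move=> ip bZ; elim=> [|P a b h IP _ [g <-]]; first by exists 0; rewrite comp0m.
have [a' <-] := injM ip bZ IP a.
by exists (b ∘ a' + g); rewrite compDl compA.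
Qed.

Section HullMap.
Variables (X I Z X' I' Z' : A) (i : hom X I) (p : hom I Z) (i' : hom X' I')
  (p' : hom I' Z').
Hypotheses (ip : short_exact i p) (ip' : short_exact i' p').
Hypotheses (bZ : (cof M `&` fib M) Z) (PI' : proj_inj M I').

Lemma hull_map_exists (f : hom X X') : exists h, hull_map i p i' p' f h.
Proof.
have [g gi] := injM ip bZ PI' (i' ∘ f).
have [|h hp] := cokernel_desc (t := p' ∘ g) (proj2 ip).
  by rewrite -compA gi compA (short_exact_comp0 ip') comp0m.
by exists h, g.
Qed.

(** [f - f'] extends to the hull as [e]. Subtracting [i' ∘ e] from [g - g'] leaves a map that kills
    [X], so [h - h'] factors through the hull [I']. *)
Lemma hull_map_unique (f f' : hom X X') (h h' : hom Z Z') :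
  hull_map i p i' p' f h -> hull_map i p i' p' f' h' -> stable_eq M f f' ->
  stable_eq M h h'.
Proof.
move=> [g [gi hp]] [g' [gi' hp']] /(factors_extend ip bZ)[e ei].
have [|k kp] := cokernel_desc (t := g - g' - i' ∘ e) (proj2 ip).
  rewrite !compDl !compNm -compA ei gi gi' compDr compmN.
  by rewrite subrr.
rewrite /stable_eq; suff -> : h - h' = p' ∘ k by exact: factors_proj_inj.
apply: (short_exact_epi ip); rewrite -compA kp compDl compNm hp hp'.
by rewrite !compDr !compmN compA (short_exact_comp0 ip') comp0m subr0.
Qed.

End HullMap.

Lemma cone_map (X I Z I' Z' Y W W' : A) (i : hom X I) (p : hom I Z)
    (i' : hom X I') (p' : hom I' Z') (f : hom X Y)
    (j : hom I W) (m2 : hom Y W) (m3 : hom W Z)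
    (j' : hom I' W') (m2' : hom Y W') (m3' : hom W' Z') (g : hom I I') (h : hom Z Z') :
  is_pushout i f j m2 -> m3 ∘ m2 = 0 -> m3 ∘ j = p ->
  is_pushout i' f j' m2' -> m3' ∘ m2' = 0 -> m3' ∘ j' = p' ->
  g ∘ i = i' -> h ∘ p = p' ∘ g ->
  exists c : hom W W', [/\ c ∘ j = j' ∘ g, c ∘ m2 = m2' & m3' ∘ c = h ∘ m3].
Proof.
move=> po m32 m3j po' m32' m3j' gi hp.
have [|c [cj cm]] := pushout_desc (s := j' ∘ g) (t := m2') po.
  by rewrite -compA gi (proj1 po').
exists c; split=> //; apply: (pushout_hom_ext po).
  by rewrite -!compA cj m3j hp compA m3j'.
by rewrite -!compA cm m32 m32' compm0.
Qed.

(** [g - idm I] kills [X], hence factors through [p]; this makes [c - idm W] factor through [I]. *)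
Lemma cone_endo (X I Z Y W : A) (i : hom X I) (p : hom I Z) (f : hom X Y)
    (j : hom I W) (m2 : hom Y W) (m3 : hom W Z) (g : hom I I) (c : hom W W) :
  short_exact i p -> proj_inj M I ->
  is_pushout i f j m2 -> m3 ∘ m2 = 0 -> m3 ∘ j = p ->
  g ∘ i = i -> c ∘ j = j ∘ g -> c ∘ m2 = m2 -> stable_eq M c (idm W).
Proof.
move=> ip PI po m32 m3j gi cj cm.
have [|k kp] := cokernel_desc (t := g - idm I) (proj2 ip).
  by rewrite compDl compNm gi comp1m subrr.
rewrite /stable_eq; suff -> : c - idm W = j ∘ (k ∘ m3) by exact: factors_proj_inj.
apply: (pushout_hom_ext po); rewrite compDl compNm comp1m -!compA.
  by rewrite cj m3j kp compDr compmN compm1.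
by rewrite cm m32 !compm0 subrr.
Qed.

(** A cone does not depend, stably, on the hull used to build it. *)
Lemma cone_iso (X I Z I' Z' Y W W' : A) (i : hom X I) (p : hom I Z)
    (i' : hom X I') (p' : hom I' Z') (f : hom X Y)
    (j : hom I W) (m2 : hom Y W) (m3 : hom W Z)
    (j' : hom I' W') (m2' : hom Y W') (m3' : hom W' Z') (h : hom Z Z') (h' : hom Z' Z) :
  short_exact i p -> short_exact i' p' -> proj_inj M I -> proj_inj M I' ->
  is_pushout i f j m2 -> m3 ∘ m2 = 0 -> m3 ∘ j = p ->
  is_pushout i' f j' m2' -> m3' ∘ m2' = 0 -> m3' ∘ j' = p' ->
  hull_map i p i' p' (idm X) h -> hull_map i' p' i p (idm X) h' ->
  exists (c : hom W W') (c' : hom W' W), [/\ c ∘ m2 = m2', m3' ∘ c = h ∘ m3,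
    stable_eq M (c' ∘ c) (idm W) & stable_eq M (c ∘ c') (idm W')].
Proof.
move=> ip ip' PI PI' po m32 m3j po' m32' m3j'.
rewrite /hull_map !compm1 => -[g [gi hp]] [g' [gi' hp']].
have [c [cj cm c3]] := cone_map po m32 m3j po' m32' m3j' gi hp.
have [c' [c'j c'm c'3]] := cone_map po' m32' m3j' po m32 m3j gi' hp'.
exists c, c'; split=> //.
  apply: (cone_endo ip PI po m32 m3j (g := g' ∘ g)).
  - by rewrite -compA gi.
  - by rewrite -compA cj [c' ∘ _]compA c'j compA.
  - by rewrite -compA cm.
apply: (cone_endo ip' PI' po' m32' m3j' (g := g ∘ g')).
- by rewrite -compA gi'.
- by rewrite -compA c'j [c ∘ _]compA cj compA.
- by rewrite -compA c'm.
Qed.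

End HullMaps.

Lemma hull_map_fmap (A A' : preadditive) (Φ : add_functor A A') (X I Z X' I' Z' : A)
    (i : hom X I) (p : hom I Z) (i' : hom X' I') (p' : hom I' Z') (f : hom X X')
    (h : hom Z Z') :
  hull_map i p i' p' f h ->
  hull_map (fmap Φ i) (fmap Φ p) (fmap Φ i') (fmap Φ p') (fmap Φ f) (fmap Φ h).
Proof. by move=> [g [gi hp]]; exists (fmap Φ g); rewrite -!fmap_comp gi hp. Qed.

Lemma map_triangle_iso (C C' : category) (G : functor C C') (S : functor C C)
    (S' : functor C' C') xi (t t' : triangle S) :
  is_nat_iso (F := functor_comp G S) (G := functor_comp S' G) xi ->
  tri_iso t t' -> tri_iso (map_triangle xi t) (map_triangle xi t').
Proof.
move=> [_ xi_nat] [a [b [c [[ia ib ic] [s1 s2 s3]]]]].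
exists (onmor G a), (onmor G b), (onmor G c); split; first by split; exact: onmor_equiv_mor.
split=> /=; rewrite -?onmor_comp ?s1 ?s2 //.
rewrite mcompA; have /= <- := xi_nat _ _ a.
by rewrite -!mcompA -!onmor_comp s3.
Qed.

(** * Additive functors that induce triangle functors on stable categories *)

Section StableFunctor.
Variables (A A' : abelian) (M : triple A) (M' : triple A') (Φ : add_functor A A').
Hypothesis Φbif : forall X, (cof M `&` fib M) X -> (cof M' `&` fib M') (Φ X).
Hypothesis Φpi : forall X, proj_inj M X -> proj_inj M' (Φ X).

Lemma factors_fmap (X Y : A) (f : hom X Y) : factors M f -> factors M' (fmap Φ f).
Proof.
elim=> [|P a b g PP _ IH]; first by rewrite fmap_zero; constructor.
by rewrite fmapD fmap_comp; constructor=> //; exact: Φpi.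
Qed.

Lemma stable_eq_fmap (X Y : A) (f g : hom X Y) :
  stable_eq M f g -> stable_eq M' (fmap Φ f) (fmap Φ g).
Proof. by move=> /factors_fmap; rewrite fmapD fmap_opp. Qed.

Definition stable_functor : functor (stable M) (stable M').
Proof.
exists (fun X : stable M => exist _ (Φ (sval X)) (Φbif (svalP X)) : stable M')
  (fun (X Y : stable M) (f : mor X Y) => fmap Φ (f : hom (sval X) (sval Y))).
- by move=> X Y f g; exact: stable_eq_fmap.
- by move=> X; rewrite /= fmap1; exact: stable_eq_refl.
- by move=> X Y Z g f; rewrite /= fmap_comp; exact: stable_eq_refl.
Defined.

Hypothesis Φses : forall (X I Z : A) (i : hom X I) (p : hom I Z), short_exact i p ->
  (cof M `&` fib M) X -> proj_inj M I -> (cof M `&` fib M) Z ->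
  short_exact (fmap Φ i) (fmap Φ p).
Hypotheses (injM : relatively_injective M) (injM' : relatively_injective M').
Variables (S : suspension M) (S' : suspension M').

(* The comparison of the two shifts is induced by an identity; by
   hull_map_unique this determines it stably. *)
Definition is_shift_comparison
    (xi : forall X, mor (stable_functor (S X)) (S' (stable_functor X))) :=
  forall X, hull_map (fmap Φ (hull_in S X)) (fmap Φ (hull_pr S X))
    (hull_in S' (stable_functor X)) (hull_pr S' (stable_functor X))
    (idm (Φ (sval X))) (xi X).

Lemma fmap_hull_exact X : short_exact (fmap Φ (hull_in S X)) (fmap Φ (hull_pr S X)).
Proof.
by apply: Φses; [exact: hull_exact|exact: svalP|exact: hull_proj_inj|exact: svalP].
Qed.

Lemma shift_comparison_exists : exists xi, is_shift_comparison xi.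
Proof.
suff P X : {h | hull_map (fmap Φ (hull_in S X)) (fmap Φ (hull_pr S X))
    (hull_in S' (stable_functor X)) (hull_pr S' (stable_functor X)) (idm (Φ (sval X))) h}.
  by exists (fun X => sval (P X)) => X; exact: svalP (P X).
apply/cid/(hull_map_exists injM' (fmap_hull_exact X) (hull_exact S' _)).
  exact: Φbif (svalP (S X)).
exact: hull_proj_inj.
Qed.

Variable xi : forall X, mor (stable_functor (S X)) (S' (stable_functor X)).
Hypothesis xiP : is_shift_comparison xi.

Lemma shift_comparison_inv X : exists h : hom (sval (S' (stable_functor X))) (Φ (sval (S X))),
  [/\ hull_map (hull_in S' (stable_functor X)) (hull_pr S' (stable_functor X))
        (fmap Φ (hull_in S X)) (fmap Φ (hull_pr S X)) (idm (Φ (sval X))) h,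
      stable_eq M' (h ∘ (xi X : hom _ _)) (idm _)
    & stable_eq M' ((xi X : hom _ _) ∘ h) (idm _)].
Proof.
have ΦPI := Φpi (hull_proj_inj S X); have PI' := hull_proj_inj S' (stable_functor X).
have Φb := Φbif (svalP (S X)); have b' := svalP (S' (stable_functor X)).
have [h hP] := hull_map_exists injM' (hull_exact S' _) (fmap_hull_exact X) b' ΦPI (idm _).
exists h; split=> //.
  apply: (hull_map_unique injM' (fmap_hull_exact X) (fmap_hull_exact X) Φb ΦPI
            (hull_map_comp hP (xiP X)) (hull_map_id _ _)).
  by rewrite comp1m; exact: stable_eq_refl.
apply: (hull_map_unique injM' (hull_exact S' _) (hull_exact S' _) b' PI'
          (hull_map_comp (xiP X) hP) (hull_map_id _ _)).
by rewrite comp1m; exact: stable_eq_refl.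
Qed.

(** Both ways around the naturality square are hull maps over [fmap Φ f], so [hull_map_unique]
    identifies them. *)
Lemma shift_comparison_nat_iso :
  is_nat_iso (F := functor_comp stable_functor S) (G := functor_comp S' stable_functor) xi.
Proof.
split=> [X|X Y f]; first by have [h [_ ? ?]] := shift_comparison_inv X; exists h.
have [g [h [gi hp Sf]]] := susp_induced S (f : hom (sval X) (sval Y)).
have [g' [h' [gi' hp' Sf']]] :=
  susp_induced S' (onmor stable_functor f :
    hom (sval (stable_functor X)) (sval (stable_functor Y))).
have hP : hull_map (hull_in S X) (hull_pr S X) (hull_in S Y) (hull_pr S Y) f h by exists g.
have hP' : hull_map (hull_in S' (stable_functor X)) (hull_pr S' (stable_functor X))
  (hull_in S' (stable_functor Y)) (hull_pr S' (stable_functor Y)) (fmap Φ f) h' by exists g'.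
have e : onmor (functor_comp stable_functor S) f ≈
    (fmap Φ h : @mor (stable M') (stable_functor (S X)) (stable_functor (S Y))).
  exact: stable_eq_fmap Sf.
have e' : onmor (functor_comp S' stable_functor) f ≈
    (h' : @mor (stable M') (S' (stable_functor X)) (S' (stable_functor Y))) by exact: Sf'.
rewrite e e'.
apply: (hull_map_unique injM' (fmap_hull_exact X) (hull_exact S' _) (Φbif (svalP (S X)))
  (hull_proj_inj S' _) (hull_map_comp (xiP Y) (hull_map_fmap Φ hP))
  (hull_map_comp hP' (xiP X))).
by rewrite comp1m compm1; exact: stable_eq_refl.
Qed.

Hypothesis Φpo : forall (X Y Y' Z : A) (a : hom X Y) (b : hom X Y') (c : hom Y Z)
  (d : hom Y' Z), is_pushout a b c d ->
  is_pushout (fmap Φ a) (fmap Φ b) (fmap Φ c) (fmap Φ d).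
Hypothesis extM' : forall (X Y Z : A') (i : hom X Y) (p : hom Y Z), short_exact i p ->
  (cof M' `&` fib M') X -> (cof M' `&` fib M') Z -> (cof M' `&` fib M') Y.

(** [Φ] of a cone is a cone over the image of the hull, not over the hull chosen by [S']. The
    standard triangle on the latter has a bifibrant vertex [W] by extension closure, and [cone_iso]
    compares the two. *)
Lemma stable_functor_standard (t : triangle S) : standard_triangle t ->
  @distinguished _ (stable_tri S') (map_triangle xi t).
Proof.
case: t => X Y Z m1 m2 m3 [] /= j [po m32 m3j].
pose GX := stable_functor X; pose GY := stable_functor Y.
have [W [j' [m2' po']]] := pushout_exists (hull_in S' GX) (fmap Φ (m1 : hom (sval X) (sval Y))).
have [m3' [m3j' m2m3]] := pushout_short_exact po' (hull_exact S' GX).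
have bW : (cof M' `&` fib M') W.
  exact: (extM' m2m3 (svalP GY) (svalP (S' GX))).
pose Z' : stable M' := exist _ W bW.
have m32' := short_exact_comp0 m2m3.
exists (@Triangle (stable M') S' GX GY Z' (fmap Φ (m1 : hom (sval X) (sval Y)))
  m2' m3'); first by exists j'.
have [h [hP hx xh]] := shift_comparison_inv X.
have Φm32 : fmap Φ (m3 : hom (sval Z) (sval (S X))) ∘ fmap Φ (m2 : hom (sval Y) (sval Z)) = 0.
  by rewrite -fmap_comp m32 fmap_zero.
have Φm3j : fmap Φ (m3 : hom (sval Z) (sval (S X))) ∘ fmap Φ j = fmap Φ (hull_pr S X).
  by rewrite -fmap_comp m3j.
have [c' [c [c'm c'3 cc' c'c]]] := cone_iso (hull_exact S' GX) (fmap_hull_exact X)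
  (hull_proj_inj S' GX) (Φpi (hull_proj_inj S X)) po' m32' m3j' (Φpo po) Φm32 Φm3j hP (xiP X).
exists (mid GX), (mid GY), (c' : @mor (stable M') Z' (stable_functor Z)).
split; split.
- exact: equiv_mor_id.
- exact: equiv_mor_id.
- by exists c.
- by rewrite mcomp1m mcompm1.
- rewrite mcompm1; change (stable_eq M' (c' ∘ m2') (fmap Φ (m2 : hom (sval Y) (sval Z)))).
  by rewrite c'm; exact: stable_eq_refl.
- rewrite onmor1 mcomp1m.
  change (stable_eq M' m3' ((xi X : hom _ _) ∘ fmap Φ (m3 : hom (sval Z) (sval (S X))) ∘ c')).
  rewrite -compA c'3 compA.
  rewrite -{1}[m3']comp1m /stable_eq -compNm -compDl; apply: factors_compr.
  by rewrite -opprB; exact: factors_opp.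
Qed.

Lemma stable_functor_distinguished (t : triangle S) : @distinguished _ (stable_tri S) t ->
  @distinguished _ (stable_tri S') (map_triangle xi t).
Proof.
move=> [t0 /stable_functor_standard st0 t0t].
apply: distinguished_iso st0; apply: map_triangle_iso t0t.
exact: shift_comparison_nat_iso.
Qed.

End StableFunctor.

Section HoveyStable.
Variables (A : abelian) (M : triple A).
Hypotheses (epA : enough_projectives A) (hM : hereditary_Hovey_triple M).

Lemma Hovey_ext1 (X Y : A) : cof M X -> (fib M `&` triv M) Y -> ext1 X Y.
Proof. by have [_ hCF _] := hM; exact: (cotorsion_ext1 epA hCF). Qed.

Lemma Hovey_relatively_injective : relatively_injective M.
Proof.
move=> X Y Z I i p ip [CZ _] [[_ FI] WI] f.
exact: (Hovey_ext1 CZ (conj FI WI) ip f).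
Qed.

Lemma Hovey_bifibrant_extension (X Y Z : A) (i : hom X Y) (p : hom Y Z) :
  short_exact i p -> (cof M `&` fib M) X -> (cof M `&` fib M) Z -> (cof M `&` fib M) Y.
Proof.
have [hCW hCF _] := hM; move=> ip [CX FX] [CZ FZ]; split.
  exact: (cotorsion_left_extension epA hCF ip).
exact: (cotorsion_right_extension epA hCW ip).
Qed.

Lemma iso_stable (X Y : stable M) (f : hom (sval X) (sval Y)) :
  is_iso f -> is_equiv_mor (f : @mor (stable M) X Y).
Proof.
move=> [g [gf fg]]; exists (g : @mor (stable M) Y X); split.
  by rewrite /= gf; exact: stable_eq_refl.
by rewrite /= fg; exact: stable_eq_refl.
Qed.

End HoveyStable.

(** * The cokernel of the action as a functor *)

Section CokernelFunctor.
Variables (B : abelian) (F : add_functor B B) (rexF : right_exact F).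
Local Notation E := (trivial_extension rexF).
Local Notation U := (U rexF).
Local Notation TF := (TF rexF).
Local Notation in1T X := (in1 (biprod X (F X))).

Lemma coker_functor_exists : exists (K : add_functor E B) (q : forall Y, hom (U Y) (K Y)),
  (forall Y : E, is_cokernel (act Y) (q Y)) /\
  forall (X Y : E) (f : hom X Y), fmap K f ∘ q X = q Y ∘ fmap U f.
Proof.
have pick (Y : E) : {t : {Q : B & hom (U Y) Q} | is_cokernel (act Y) (tagged t)}.
  apply: cid; have [Q [q qP]] := @has_cokernels B (F (U Y)) (U Y) (act Y).
  by exists (Tagged (fun Q => hom (U Y) Q : Type) q).
pose K Y := tag (sval (pick Y)); pose q Y : hom (U Y) (K Y) := tagged (sval (pick Y)).
have qP Y : is_cokernel (act Y) (q Y) by exact: (svalP (pick Y)).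
have lift (X Y : E) (f : hom X Y) : {h : hom (K X) (K Y) | h ∘ q X = q Y ∘ fmap U f}.
  apply: cid; apply: (cokernel_desc (qP X)).
  by rewrite -compA (U_act f) compA (proj1 (qP Y)) comp0m.
have qe Y : is_epi (q Y) := cokernel_epi (qP Y).
have liftE (X Y : E) (f : hom X Y) : sval (lift _ _ f) ∘ q X = q Y ∘ fmap U f.
  exact: (svalP (lift _ _ f)).
unshelve eexists (@AddFunctor E B K (fun X Y f => sval (lift X Y f)) _ _ _).
- by move=> X; apply: qe; rewrite liftE fmap1 comp1m compm1.
- move=> X Y Z g f; apply: qe.
  by rewrite liftE fmap_comp -compA liftE !compA liftE.
- by move=> X Y f g; apply: qe; rewrite compDl !liftE fmapD compDr.
by exists q; split.
Qed.

Variables (K : add_functor E B) (q : forall Y, hom (U Y) (K Y)).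
Hypothesis qP : forall Y : E, is_cokernel (act Y) (q Y).
Hypothesis qN : forall (X Y : E) (f : hom X Y), fmap K f ∘ q X = q Y ∘ fmap U f.

(** The right adjoint equips [Y] with the zero action. *)
Lemma coker_left_adjoint : left_adjoint K.
Proof.
move=> Y; have a0 : (0 : hom (F Y) Y) ∘ fmap F (0 : hom (F Y) Y) = 0 by exact: comp0m.
pose R : E := RtrivOb a0.
have [|ε εq] := cokernel_desc (t := (idm Y : hom (U R) Y)) (qP R); first by rewrite compm0.
exists R, ε => X f.
have e : (f ∘ q X : hom (U X) (U R)) ∘ act X = act R ∘ fmap F (f ∘ q X : hom (U X) (U R)).
  by rewrite -compA (proj1 (qP X)) compm0 comp0m.
have εE (g : hom X R) : ε ∘ fmap K g ∘ q X = fmap U g.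
  by rewrite -compA qN compA εq comp1m.
exists (Ulift e); split; first by apply: (cokernel_epi (qP X)); rewrite εE.
by move=> g gf; apply: U_inj; rewrite U_lift -gf εE.
Qed.

(** A fragment of the snake lemma: the obstruction to [fmap K i] being mono comes from the kernel of
    [act Z], which is zero. *)
Lemma coker_short_exact (X Y Z : E) (i : hom X Y) (p : hom Y Z) :
  is_mono (act Z) -> short_exact i p -> short_exact (fmap K i) (fmap K p).
Proof.
move=> aZ ip; apply: short_exact_mono_coker; last first.
  exact: (left_adjoint_cokernel coker_left_adjoint (proj2 ip)).
have Uip := U_short_exact ip.
apply: mono0 => T0 y iy.
have [T1 [c1 [x [c1e qx]]]] := epi_cover y (cokernel_epi (qP X)).
have [|T2 [c2 [v [c2e av]]]] := exact_cover (y := fmap U i ∘ x) (cokernel_exact (qP Y)).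
  by rewrite compA -qN -compA qx compA iy comp0m.
have pv : fmap F (fmap U p) ∘ v = 0.
  apply: (monoP aZ).
  by rewrite compA -(U_act p) -compA av !compA (short_exact_comp0 Uip) !comp0m.
have [T3 [c3 [w [c3e iw]]]] := exact_cover (cokernel_exact (rexF (proj2 Uip))) pv.
have e : act X ∘ w = x ∘ c2 ∘ c3.
  apply: (short_exact_mono Uip).
  by rewrite compA (U_act i) -[LHS]compA iw !compA av.
apply: (epiP c1e); apply: (epiP c2e); apply: (epiP c3e).
by rewrite -qx -!compA [x ∘ _]compA -e compA (proj1 (qP X)) comp0m.
Qed.

Definition coker_unit (X : B) : hom X (K (TF X)) := q (T rexF X) ∘ in1T X.

Lemma coker_unit_nat (X Y : B) (f : hom X Y) :
  coker_unit Y ∘ f = fmap K (fmap TF f) ∘ coker_unit X.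
Proof. by rewrite compA qN -!compA TF_in1. Qed.

Hypothesis F2 : forall X : B, is_zero_ob (F (F X)).

(** By [T_act_cokernel], [pr1] is a cokernel of [act (T X)], and [in1] is a section of it. *)
Lemma coker_unit_iso (X : B) : is_iso (coker_unit X).
Proof.
have pP := T_act_cokernel rexF X.
have [h hp] := cokernel_desc (qP (T rexF X)) (proj1 pP).
have [h' hq] := cokernel_desc pP (proj1 (qP (T rexF X))).
exists h; split; first by rewrite compA hp pr1_in1.
apply: (cokernel_epi (qP (T rexF X))).
rewrite -compA hp comp1m /coker_unit -hq.
by rewrite -[h' ∘ _ ∘ in1T X]compA pr1_in1 compm1.
Qed.

Section TClass.
Variables (C : set B) (Y : E).
Hypothesis CY : T_class (rexF := rexF) C Y.

Lemma T_class_act_mono : is_mono (act Y).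
Proof.
have [X _ [f [g [gf fg]]]] := CY.
apply: (@mono_of_comp _ _ _ _ (fmap U f)); rewrite (U_act f).
apply: mono_comp; first exact: T_act_mono.
by apply: (@mono_split _ _ _ _ (fmap F (fmap U g))); rewrite -!fmap_comp gf !fmap1.
Qed.

Lemma T_class_coker : exists2 X, C X & isomorphic (K Y) X.
Proof.
have [X CX [f [g [gf fg]]]] := CY; exists X => //.
have [u [h [hu uh]]] : exists u : hom X (K (T rexF X)), is_iso u.
  by exists (coker_unit X); exact: coker_unit_iso.
exists (h ∘ fmap K f), (fmap K g ∘ u); split; rewrite !compA.
  by rewrite (comp_1 _ uh) -fmap_comp gf fmap1.
by rewrite -[h ∘ _ ∘ _]compA -fmap_comp fg fmap1 compm1.
Qed.

Lemma T_class_section : exists s, q Y ∘ s = idm (K Y).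
Proof.
have [X _ [f [g [gf fg]]]] := CY.
have [h [hu uh]] := coker_unit_iso X.
exists (fmap U g ∘ in1T X ∘ h ∘ fmap K f).
have {}uh : q (T rexF X) ∘ (in1T X ∘ h) = idm (K (T rexF X)) by rewrite compA.
rewrite !compA -qN -[_ ∘ in1T X ∘ h]compA -[_ ∘ _ ∘ (in1T X ∘ h)]compA uh compm1.
by rewrite -fmap_comp gf fmap1.
Qed.

End TClass.

End CokernelFunctor.

(** * [T] as a triangle equivalence of stable categories *)

Section StableEquivalence.
Variables (B : abelian) (F : add_functor B B) (rexF : right_exact F).
Hypotheses (epB : enough_projectives B) (F2 : forall X : B, is_zero_ob (F (F X))).
Variable M : triple B.
Hypotheses (hM : hereditary_Hovey_triple M) (L1F : forall X, cof M X -> L1_zero F X).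
Hypothesis FC : forall X, cof M X -> (fib M `&` triv M) (F X).
Local Notation E := (trivial_extension rexF).
Local Notation U := (U rexF).
Local Notation TF := (TF rexF).
Local Notation ME := (rtriv_triple rexF M).

Let epE : enough_projectives E := trivial_extension_enough_projectives epB.
Let hME : hereditary_Hovey_triple ME := rtriv_Hovey_triple rexF epB F2 hM L1F FC.

Lemma TF_bifibrant (X : B) : (cof M `&` fib M) X -> (cof ME `&` fib ME) (TF X).
Proof.
have [hCW _ _] := hM; move=> [CX FX]; split; first exact: T_class_T.
apply: (cotorsion_right_extension epB hCW (biproduct_short_exact _) FX).
by case: (FC CX).
Qed.

Lemma TF_proj_inj (X : B) : proj_inj M X -> proj_inj ME (TF X).
Proof.
have [_ _ thickW] := hM; move=> [bX WX]; split; first exact: TF_bifibrant.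
by apply: thick_biproduct => //; case: (FC (proj1 bX)).
Qed.

Lemma TF_hull (X I Z : B) (i : hom X I) (p : hom I Z) : short_exact i p ->
  (cof M `&` fib M) X -> proj_inj M I -> (cof M `&` fib M) Z ->
  short_exact (fmap TF i) (fmap TF p).
Proof.
move=> ip _ _ [CZ _]; have [_ hCF _] := hM.
exact: (TF_short_exact_class rexF epB L1F CZ ip).
Qed.

Variables (K : add_functor E B) (q : forall Y, hom (U Y) (K Y)).
Hypothesis qP : forall Y : E, is_cokernel (act Y) (q Y).
Hypothesis qN : forall (X Y : E) (f : hom X Y), fmap K f ∘ q X = q Y ∘ fmap U f.

Lemma coker_bifibrant (Y : E) : (cof ME `&` fib ME) Y -> (cof M `&` fib M) (K Y).
Proof.
have [hCW hCF _] := hM; move=> [CY FY]; split.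
  have [X CX [f [g [gf _]]]] := T_class_coker qP CY.
  exact: (cotorsion_left_retract epB hCF gf CX).
have [s qs] := T_class_section qP qN CY.
exact: (cotorsion_right_retract epB hCW qs FY).
Qed.

Lemma coker_proj_inj (Y : E) : proj_inj ME Y -> proj_inj M (K Y).
Proof.
have [_ _ thickW] := hM; move=> [bY WY]; split; first exact: coker_bifibrant.
have : T_class (rexF := rexF) (cof M `&` triv M) Y.
  by rewrite -(T_class_triv rexF hM FC); split=> //; case: bY.
by move=> /(T_class_coker qP)[X [_ WX] KX]; exact: (thick_iso thickW KX WX).
Qed.

Lemma coker_hull (X I Z : E) (i : hom X I) (p : hom I Z) : short_exact i p ->
  (cof ME `&` fib ME) X -> proj_inj ME I -> (cof ME `&` fib ME) Z ->
  short_exact (fmap K i) (fmap K p).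
Proof.
move=> ip _ _ [CZ _]; apply: (coker_short_exact qP qN) ip.
exact: (T_class_act_mono F2 CZ).
Qed.

Variables (S : suspension M) (SE : suspension ME).

Definition stable_T := stable_functor TF_bifibrant TF_proj_inj.
Definition stable_coker := stable_functor coker_bifibrant coker_proj_inj.

(* Both sides agree after q Y', so they differ by a map through F (K Y'), which
   lies in fib ∩ triv: that map extends to the hull of K Y. *)
Lemma coker_counit_nat (Y Y' : E) (f : hom Y Y') (s : hom (K Y) (U Y))
    (s' : hom (K Y') (U Y')) :
  (cof ME `&` fib ME) Y -> cof ME Y' -> q Y ∘ s = idm _ -> q Y' ∘ s' = idm _ ->
  stable_eq ME (T_adj s' ∘ fmap TF (fmap K f)) (f ∘ T_adj s).
Proof.
move=> bY CY' qs qs'; pose X : stable M := exist _ (K Y) (coker_bifibrant bY).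
pose φ := s' ∘ fmap K f - fmap U f ∘ s.
have [|h hφ] := kernel_lift (t := φ) (mono_ker_coker (T_class_act_mono F2 CY') (qP Y')).
  rewrite compDr compmN !compA qs' comp1m -qN -compA qs compm1.
  by rewrite subrr.
have CKY' : cof M (K Y').
  have [_ hCF _] := hM; have [X0 CX [u [v [vu _]]]] := T_class_coker qP CY'.
  exact: (cotorsion_left_retract epB hCF vu CX).
have CZ : cof M (sval (S X)) by case: (svalP (S X)).
(* The difference [φ] is [act Y' ∘ h]. Passing to [F (K Y')] makes [FC] applicable, as [K Y'] is in
   [cof M]; [fmap F s'] then brings the extension back to [F (U Y')]. *)
have [g gi] := Hovey_ext1 epB hM CZ (FC CKY') (hull_exact S X) (fmap F (q Y') ∘ h).
pose a : hom (hull S X) (U Y') := act Y' ∘ (fmap F s' ∘ g).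
have aφ : a ∘ hull_in S X = φ.
  by rewrite -!compA gi [fmap F s' ∘ _]compA (fmap_section F2 (qP Y') qs') comp1m.
rewrite /stable_eq.
suff -> : T_adj s' ∘ fmap TF (fmap K f) - f ∘ T_adj s = T_adj a ∘ fmap TF (hull_in S X).
  by apply: factors_proj_inj; apply: TF_proj_inj; exact: hull_proj_inj.
apply: T_hom_ext.
rewrite fmapD fmap_opp compDl compNm !fmap_comp -!compA !TF_in1 !compA !T_adj_in1.
by rewrite -compA T_adj_in1 aφ.
Qed.

(** The unit is already natural in [B]. The counit consists of isomorphisms in the trivial
    extension, but they depend on chosen sections and are shown to be natural only stably. *)
Lemma stable_T_equivalence : is_equivalence stable_T.
Proof.
exists stable_coker; split.
  exists (fun X : stable M => coker_unit q (sval X)); split=> [X|X Y f].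
    by apply: iso_stable; exact: (coker_unit_iso qP).
  rewrite /=; rewrite (coker_unit_nat qN).
  exact: stable_eq_refl.
have sec (Y : stable ME) : {s | q (sval Y) ∘ s = idm _}.
  apply: cid; exact: (T_class_section qP qN (proj1 (svalP Y))).
exists (fun Y : stable ME => T_adj (sval (sec Y))); split=> [Y|Y Y' f].
  apply: iso_stable; apply: (T_adj_iso F2 (qP _) (svalP (sec Y))).
  exact: (T_class_act_mono F2 (proj1 (svalP Y))).
exact: (coker_counit_nat _ (svalP Y) (proj1 (svalP Y')) (svalP (sec Y)) (svalP (sec Y'))).
Qed.

Lemma stable_T_reflects xiT xiK (t : triangle S) :
  is_shift_comparison (Φbif := TF_bifibrant) (Φpi := TF_proj_inj) (S := S) (S' := SE) xiT ->
  is_shift_comparison (Φbif := coker_bifibrant) (Φpi := coker_proj_inj) (S := SE) (S' := S) xiK ->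
  tri_iso t (map_triangle xiK (map_triangle xiT t)).
Proof.
move=> xiTP xiKP; have injM := Hovey_relatively_injective epB hM.
pose η (X : stable M) : @mor (stable M) X (stable_coker (stable_T X)) := coker_unit q (sval X).
have ηi X : is_equiv_mor (η X) by apply: iso_stable; exact: (coker_unit_iso qP).
have ηN (X Y : stable M) (f : mor X Y) :
    η Y ⊙ f ≈ onmor stable_coker (onmor stable_T f) ⊙ η X.
  by rewrite /= /η (coker_unit_nat qN); exact: stable_eq_refl.
case: t => X Y Z m1 m2 m3.
exists (η X), (η Y), (η Z); split; first by split; exact: ηi.
split; [exact: ηN|exact: ηN|].
have [g [h [gi hp Sη]]] := susp_induced S (η X : hom (sval X) (sval (stable_coker (stable_T X)))).
have hP : hull_map (hull_in S X) (hull_pr S X) (hull_in S (stable_coker (stable_T X)))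
  (hull_pr S (stable_coker (stable_T X))) (η X) h by exists g.
have hη : hull_map (hull_in S X) (hull_pr S X) (fmap K (fmap TF (hull_in S X)))
    (fmap K (fmap TF (hull_pr S X))) (coker_unit q (sval X)) (coker_unit q (sval (S X))).
  by exists (coker_unit q (hull S X)); rewrite !(coker_unit_nat qN).
(* Both sides are hull maps over the unit at [X]: the left one by the definition of the suspension,
   the right one as a composite of comparisons over identities with the unit at the hull. *)
have e : onmor S (η X) ≈ xiK (stable_T X) ⊙ (onmor stable_coker (xiT X) ⊙ η (S X)).
  apply: (meq_trans (Sη : onmor S (η X) ≈
    (h : @mor (stable M) (S X) (S (stable_coker (stable_T X)))))).
  apply: (hull_map_unique injM (hull_exact S X) (hull_exact S _) (svalP (S X))
    (hull_proj_inj S _) hP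
    (hull_map_comp (xiKP (stable_T X)) (hull_map_comp (hull_map_fmap K (xiTP X)) hη))).
  by rewrite fmap1 !comp1m; exact: stable_eq_refl.
change (onmor S (η X) ⊙ m3 ≈
  (xiK (stable_T X) ⊙ onmor stable_coker (xiT X ⊙ onmor stable_T m3)) ⊙ η Z).
rewrite e onmor_comp.
rewrite -!mcompA ηN; exact: meq_refl.
Qed.

Lemma stable_T_triangle_equivalence :
  triangle_equivalence (stable_tri S) (stable_tri SE) stable_T.
Proof.
have injM := Hovey_relatively_injective epB hM.
have injME := Hovey_relatively_injective epE hME.
have [xiT xiTP] := shift_comparison_exists TF_bifibrant TF_proj_inj TF_hull injME S SE.
have [xiK xiKP] := shift_comparison_exists coker_bifibrant coker_proj_inj coker_hull injM SE S.
split; first exact: stable_T_equivalence.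
exists xiT; split; first exact: (shift_comparison_nat_iso TF_hull injME xiTP).
have poT := @left_adjoint_pushout _ _ _ (@TF_left_adjoint B F rexF).
have poK := @left_adjoint_pushout _ _ _ (coker_left_adjoint qP qN).
have extM := @Hovey_bifibrant_extension _ _ epB hM.
have extME := @Hovey_bifibrant_extension _ _ epE hME.
move=> t; split; first exact: (stable_functor_distinguished TF_hull injME xiTP poT extME).
(* Reflection: the cokernel functor sends the distinguished image of [t] to a distinguished triangle
   isomorphic to [t]. *)
move=> /(stable_functor_distinguished coker_hull injM xiKP poK extM).
apply: distinguished_iso; apply: tri_iso_sym.
exact: stable_T_reflects.
Qed.

End StableEquivalence.

Theorem theorem3p19 (B : abelian) (F : add_functor B B) (rexF : right_exact F)
    (epB : enough_projectives B) (eiB : enough_injectives B)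
    (F2 : forall X : B, is_zero_ob (F (F X)))
    (M : triple B) (hM : hereditary_Hovey_triple M)
    (L1F : forall X, cof M X -> L1_zero F X)
    (FC : forall X, cof M X -> (fib M `&` triv M) (F X)) :
  hereditary_Hovey_triple (rtriv_triple rexF M) /\
  forall (D' : tri_structure (Ho (rtriv_triple rexF M)))
         (D : tri_structure (Ho M)),
    is_Ho_tri D' -> is_Ho_tri D ->
    exists G : functor (Ho (rtriv_triple rexF M)) (Ho M),
      triangle_equivalence D' D G.
Proof.
split; first exact: rtriv_Hovey_triple.
move=> D' D [S' [wd' eq']] [S [wd eq]].
have [K [q [qP qN]]] := coker_functor_exists rexF.
have eqT := stable_T_triangle_equivalence epB F2 hM L1F FC qP qN S S'.
(* The inverted composite starts at [stable M] and ends in the homotopy category of the trivial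
   extension. *)
have [H eqH] := triangle_equivalence_inv (triangle_equivalence_comp eq' eqT).
by exists (functor_comp (stable_to_Ho wd) H); exact: triangle_equivalence_comp eq eqH.
Qed.
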